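(* Let $H$ be a Hopf $^*$-algebra over $\mathsf{C}$ and let $\mathcal{D}$ be an admissible $^*$-algebra with $^*$-action of $H$. For idempotent non-degenerate $^*$-algebras $\mathcal{A},\mathcal{B}$ with $^*$-actions of $H$, an $H$-covariant strong Morita equivalence $(\mathcal{B},\mathcal{A})$-bimodule $\mathcal{E}$ and $\mathcal{J}\in\mathfrak{L}_{\mathcal{D},H}(\mathcal{A})$ put $$\Phi_{\mathcal{E}}(\mathcal{J})=\{b\in\mathcal{B}\mid\langle x,b\cdot y\rangle_{\mathcal{A}}\in\mathcal{J}\text{ for all }x,y\in\mathcal{E}\}.$$ Then the map $$\Phi:\mathsf{Pic}^{\mathrm{str}}_H(\mathcal{B},\mathcal{A})\times\mathfrak{L}_{\mathcal{D},H}(\mathcal{A})\longrightarrow\mathfrak{L}_{\mathcal{D},H}(\mathcal{B}),\qquad([\mathcal{E}],\mathcal{J})\mapsto\Phi_{\mathcal{E}}(\mathcal{J}),$$ defines an action of the $H$-covariant strong Picard groupoid on the lattices of $(\mathcal{D},H)$-closed ideals by lattice isomorphisms.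
   Context: **Ground ring.** $\mathsf{R}$ is an ordered ring (commutative, unital), $\mathsf{C}=\mathsf{R}(i)$ with $i^2=-1$, with complex conjugation. A $^*$-algebra over $\mathsf{C}$ is an associative $\mathsf{C}$-algebra with a $\mathsf{C}$-antilinear involutive antiautomorphism. It is *idempotent* if products $ab$ span it, *non-degenerate* if $a\mathcal{A}=0$ or $\mathcal{A}a=0$ implies $a=0$. For unital algebras, modules are unital. All modules carry a compatible $\mathsf{C}$-module structure. **Hopf $^*$-algebra.** $H$ is a Hopf algebra over $\mathsf{C}$ ($\Delta(g)=g_{(1)}\otimes g_{(2)}$, counit $\epsilon$, antipode $S$) which is also a $^*$-algebra such that $\Delta,\epsilon$ are $^*$-homomorphisms and $S(S(g)^* )^*=g$. A $^*$-action of $H$ on $\mathcal{A}$ is a left $H$-module structure (with $1_H\triangleright a=a$) with $g\triangleright(ab)=(g_{(1)}\triangleright a)(g_{(2)}\triangleright b)$, $(g\triangleright a)^*=S(g)^*\triangleright a^*$, and $g\triangleright1=\epsilon(g)1$ if $\mathcal{A}$ is unital. **Inner products.** $\omega:\mathcal{A}\to\mathsf{C}$ linear is positive if $\omega(a^*a)\ge0$; $a$ is positive if $\omega(a)\ge0$ for all positive $\omega$. An $\mathcal{A}$-valued inner product on a right $\mathcal{A}$-module is $\mathsf{C}$-sesquilinear (linear in the second argument) with $\langle x,y\cdot a\rangle=\langle x,y\rangle a$, $\langle x,y\rangle=\langle y,x\rangle^*$ (on left modules: left linear in the first argument). Non-degenerate: $\langle x,\cdot\rangle=0$ implies $x=0$.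 Full: its values span the algebra. Completely positive: $(\langle x_i,x_j\rangle)$ is positive in $M_n$ of the algebra for all $n$, $x_1,\dots,x_n$. A pre-Hilbert $\mathcal{D}$-module is a right $\mathcal{D}$-module with non-degenerate completely positive inner product; it is $H$-covariant if it is an $H$-module with $g\triangleright\langle x,y\rangle=\langle S(g_{(1)})^*\triangleright x,g_{(2)}\triangleright y\rangle$. $\mathcal{D}$ is *admissible* if on every pre-Hilbert $\mathcal{D}$-module $\langle\phi,\phi\rangle=0$ implies $\phi=0$. **Closed ideals.** An $H$-covariant $^*$-representation of $\mathcal{A}$ on an $H$-covariant pre-Hilbert $\mathcal{D}$-module $\mathcal{H}$ is a $^*$-homomorphism $\pi$ from $\mathcal{A}$ into the adjointable operators on $\mathcal{H}$ with $\pi(g\triangleright a)x=g_{(1)}\triangleright(\pi(a)(S(g_{(2)})\triangleright x))$. $\mathcal{J}\subseteq\mathcal{A}$ is a $(\mathcal{D},H)$-closed ideal if $\mathcal{J}=\ker\pi$ for some such $\pi$; $\mathfrak{L}_{\mathcal{D},H}(\mathcal{A})$ is the set of these. It is closed under arbitrary intersections; with $\mathcal{J}^{\mathrm{cl}}$ the intersection of all $(\mathcal{D},H)$-closed ideals containing $\mathcal{J}$, it is a lattice under $\mathcal{I}\wedge\mathcal{J}=\mathcal{I}\cap\mathcal{J}$, $\mathcal{I}\vee\mathcal{J}=(\mathcal{I}\cup\mathcal{J})^{\mathrm{cl}}$, ordered by inclusion. **Picard groupoid.** An $H$-covariant strong (Morita) equivalence bimodule is a $(\mathcal{B},\mathcal{A})$-bimodule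 $\mathcal{E}$ with $\mathcal{B}\cdot\mathcal{E}=\mathcal{E}=\mathcal{E}\cdot\mathcal{A}$ (spans), full non-degenerate completely positive inner products ${}_{\mathcal{B}}\langle\cdot,\cdot\rangle$ (left $\mathcal{B}$-linear) and $\langle\cdot,\cdot\rangle_{\mathcal{A}}$ (right $\mathcal{A}$-linear) with $\langle b\cdot x,y\rangle_{\mathcal{A}}=\langle x,b^*\cdot y\rangle_{\mathcal{A}}$, ${}_{\mathcal{B}}\langle x\cdot a,y\rangle={}_{\mathcal{B}}\langle x,y\cdot a^*\rangle$, ${}_{\mathcal{B}}\langle x,y\rangle\cdot z=x\cdot\langle y,z\rangle_{\mathcal{A}}$, and an $H$-module structure with $g\triangleright\langle x,y\rangle_{\mathcal{A}}=\langle S(g_{(1)})^*\triangleright x,g_{(2)}\triangleright y\rangle_{\mathcal{A}}$, $g\triangleright{}_{\mathcal{B}}\langle x,y\rangle={}_{\mathcal{B}}\langle g_{(1)}\triangleright x,S(g_{(2)})^*\triangleright y\rangle$. $\mathsf{Pic}^{\mathrm{str}}_H(\mathcal{B},\mathcal{A})$ is the class of isomorphism classes (isomorphisms preserve all structures), viewed as arrows $\mathcal{A}\to\mathcal{B}$ of a groupoid with composition $[\mathcal{F}]\circ[\mathcal{E}]=[\mathcal{F}\widetilde{\otimes}_{\mathcal{B}}\mathcal{E}]$ and units $[{}_{\mathcal{A}}\mathcal{A}_{\mathcal{A}}]$ ($\langle a,b\rangle_{\mathcal{A}}=a^*b$, ${}_{\mathcal{A}}\langle a,b\rangle=ab^*$).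 Here $\mathcal{F}\widetilde{\otimes}_{\mathcal{B}}\mathcal{E}$ is $\mathcal{F}\otimes_{\mathcal{B}}\mathcal{E}$ with $\langle y\otimes x,y'\otimes x'\rangle_{\mathcal{A}}=\langle x,\langle y,y'\rangle_{\mathcal{B}}\cdot x'\rangle_{\mathcal{A}}$ and ${}_{\mathcal{C}}\langle y\otimes x,y'\otimes x'\rangle={}_{\mathcal{C}}\langle y\cdot{}_{\mathcal{B}}\langle x,x'\rangle,y'\rangle$, divided by the common degeneracy space, with $g\triangleright(y\otimes x)=g_{(1)}\triangleright y\otimes g_{(2)}\triangleright x$. ''Action'' means: well defined on classes, $\Phi_{\mathcal{F}}\circ\Phi_{\mathcal{E}}=\Phi_{\mathcal{F}\widetilde{\otimes}\mathcal{E}}$, and $\Phi_{\mathcal{A}}=\mathrm{id}$. *)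

(* Defs.v *)
From HB Require Import structures.
From mathcomp Require Import all_boot all_order all_algebra.
From mathcomp Require Import ring.
From mathcomp Require Import boolp classical_sets functions.

Set Implicit Arguments.
Unset Strict Implicit.
Unset Printing Implicit Defensive.

Import Order.TTheory GRing.Theory Num.Theory.
Local Open Scope classical_set_scope.
Local Open Scope ring_scope.
Local Open Scope quotient_scope.

(* R(i) for an ordered ring R; the library's R[i] is a ring only over fields. *)
Record cplx (R : Type) := Cplx { cre : R; cim : R }.

Definition cplx_pair (R : Type) (z : cplx R) := (cre z, cim z).
Definition pair_cplx (R : Type) (p : R * R) := Cplx p.1 p.2.
Lemma cplx_pairK (R : Type) : cancel (@cplx_pair R) (@pair_cplx R).
Proof. by case. Qed.

HB.instance Definition _ (R : choiceType) :=
  Choice.copy (cplx R) (can_type (@cplx_pairK R)).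

Section CplxRing.
Variable R : realDomainType.
Implicit Types z w : cplx R.

Definition cplx_add z w := Cplx (cre z + cre w) (cim z + cim w).
Definition cplx_opp z := Cplx (- cre z) (- cim z).
Definition cplx_mul z w :=
  Cplx (cre z * cre w - cim z * cim w) (cre z * cim w + cim z * cre w).

Lemma cplx_addA : associative cplx_add.
Proof. by move=> [a b] [c d] [e f]; rewrite /cplx_add /= !addrA. Qed.
Lemma cplx_addC : commutative cplx_add.
Proof. by move=> [a b] [c d]; rewrite /cplx_add /= addrC [b + d]addrC. Qed.
Lemma cplx_add0 : left_id (Cplx 0 0) cplx_add.
Proof. by move=> [a b]; rewrite /cplx_add /= !add0r. Qed.
Lemma cplx_addN : left_inverse (Cplx 0 0) cplx_opp cplx_add.
Proof. by move=> [a b]; rewrite /cplx_add /= !addNr. Qed.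

HB.instance Definition _ := GRing.isZmodule.Build (cplx R)
  cplx_addA cplx_addC cplx_add0 cplx_addN.

Lemma cplx_mulA : associative cplx_mul.
Proof. by move=> [a b] [c d] [e f]; congr Cplx => /=; ring. Qed.
Lemma cplx_mulC : commutative cplx_mul.
Proof. by move=> [a b] [c d]; congr Cplx => /=; ring. Qed.
Lemma cplx_mul1 : left_id (Cplx 1 0) cplx_mul.
Proof. by move=> [a b]; congr Cplx => /=; ring. Qed.
Lemma cplx_mulD : left_distributive cplx_mul cplx_add.
Proof. by move=> [a b] [c d] [e f]; congr Cplx => /=; ring. Qed.
Lemma cplx_1neq0 : Cplx 1 0 != 0 :> cplx R.
Proof. by apply/eqP => -[] /eqP; rewrite oner_eq0. Qed.

HB.instance Definition _ := GRing.Zmodule_isComNzRing.Build (cplx R)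
  cplx_mulA cplx_mulC cplx_mul1 cplx_mulD cplx_1neq0.

Definition cconj z := Cplx (cre z) (- cim z).
Definition cnneg z := (cim z == 0) && (0 <= cre z).

Lemma cconjK : involutive cconj.
Proof. by move=> [a b]; rewrite /cconj /= opprK. Qed.
Lemma cconjM : {morph cconj : z w / z * w}.
Proof. by move=> [a b] [c d]; congr Cplx => /=; ring. Qed.
Lemma cconjD : {morph cconj : z w / z + w}.
Proof. by move=> [a b] [c d]; congr Cplx => /=; ring. Qed.
Lemma cconj1 : cconj 1 = 1.
Proof. by rewrite /cconj /= oppr0. Qed.
Lemma cconjN : {morph cconj : z / - z}.
Proof. by move=> [a b]. Qed.
Lemma cnnegD z w : cnneg z -> cnneg w -> cnneg (z + w).
Proof.
case: z w => a b [c d] /andP[/= /eqP -> a0] /andP[/= /eqP -> c0].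
by rewrite /cnneg /= addr0 eqxx addr_ge0.
Qed.
Lemma cnneg0 : cnneg 0.
Proof. by rewrite /cnneg /= eqxx lexx. Qed.

End CplxRing.

Definition addf (U V : zmodType) (f : U -> V) := forall x y, f (x + y) = f x + f y.

Section Addf.
Variables (U V : zmodType) (f : U -> V).
Hypothesis fD : addf f.
Lemma addf0 : f 0 = 0.
Proof. by apply: (addrI (f 0)); rewrite -fD !addr0. Qed.
Lemma addfN x : f (- x) = - f x.
Proof. by apply: (addrI (f x)); rewrite -fD !subrr addf0. Qed.
Lemma addfB x y : f (x - y) = f x - f y.
Proof. by rewrite fD addfN. Qed.
Lemma addf_sum (I : Type) (r : seq I) (P : pred I) F :
  f (\sum_(i <- r | P i) F i) = \sum_(i <- r | P i) f (F i).
Proof. exact: (big_morph f fD addf0). Qed.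
End Addf.

Lemma linear_addf (S : pzRingType) (U V : lmodType S) (f : U -> V) : linear f -> addf f.
Proof. by move=> fl x y; have := fl 1 x y; rewrite !scale1r. Qed.
Lemma linear_scal (S : pzRingType) (U V : lmodType S) (f : U -> V) c x :
  linear f -> f (c *: x) = c *: f x.
Proof. by move=> fl; rewrite -[c *: x]addr0 fl (addf0 (linear_addf fl)) addr0. Qed.

Section LinearAlgebra.
Variable S : pzRingType.

Definition bilin (U V W : lmodType S) (f : U -> V -> W) :=
  (forall v, linear (f^~ v)) /\ (forall u, linear (f u)).

Definition lspan (V : lmodType S) (P : set V) : set V :=
  [set v | exists (n : nat) (c : 'I_n -> S) (x : 'I_n -> V),
     (forall i, P (x i)) /\ v = \sum_i c i *: x i].

Lemma lspan_ind (V : lmodType S) (P Q : set V) :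
  Q 0 -> (forall c x y, Q x -> Q y -> Q (c *: x + y)) -> P `<=` Q -> lspan P `<=` Q.
Proof.
move=> Q0 QD PQ v [n [c [x [Px ->]]]].
elim/big_ind: _ => [//|a b Qa Qb|i _]; first by rewrite -[a]scale1r; apply: QD.
by rewrite -[X in Q X]addr0; apply: QD => //; apply: PQ.
Qed.

Record submodule (V : lmodType S) := Submodule {
  smod :> V -> Prop;
  smod0 : smod 0;
  smodD : forall c x y, smod x -> smod y -> smod (c *: x + y) }.

Section Quotient.
Variables (V : lmodType S) (W : submodule V).

Definition vequiv (x y : V) := `[< W (x - y) >].

Lemma vequiv_refl : reflexive vequiv.
Proof. by move=> x; apply/asboolP; rewrite subrr; apply: smod0. Qed.
Lemma vequiv_sym : symmetric vequiv.
Proof.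
move=> x y; apply/asboolP/asboolP => Wxy.
  by rewrite -opprB -scaleN1r -[_ *: _]addr0; apply: smodD => //; apply: smod0.
by rewrite -opprB -scaleN1r -[_ *: _]addr0; apply: smodD => //; apply: smod0.
Qed.
Lemma vequiv_trans : transitive vequiv.
Proof.
move=> y x z /asboolP Wxy /asboolP Wyz; apply/asboolP.
by rewrite -(subrKA y) -[x - y]scale1r; apply: smodD.
Qed.

Canonical vequiv_equiv := EquivRel vequiv vequiv_refl vequiv_sym vequiv_trans.
Definition vquot := {eq_quot vequiv}.
HB.instance Definition _ := Choice.on vquot.
HB.instance Definition _ := EqQuotient.on vquot.

Definition vproj (x : V) : vquot := \pi_vquot x.
Definition vrepr (q : vquot) : V := repr q.

Lemma vreprK q : vproj (vrepr q) = q. Proof. exact: reprK. Qed.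
Lemma vprojP x y : vproj x = vproj y <-> W (x - y).
Proof. by split=> [/eqquotP/asboolP//|Wxy]; apply/eqquotP/asboolP. Qed.
Lemma vreprP x : W (vrepr (vproj x) - x).
Proof. by apply/vprojP; rewrite vreprK. Qed.

Definition vq_add (p q : vquot) := vproj (vrepr p + vrepr q).
Definition vq_opp (p : vquot) := vproj (- vrepr p).
Definition vq_scale c (p : vquot) := vproj (c *: vrepr p).

Lemma vq_addE x y : vq_add (vproj x) (vproj y) = vproj (x + y).
Proof.
apply/vprojP; rewrite opprD addrACA -[X in W (X + _)]scale1r.
by apply: smodD; apply: vreprP.
Qed.
Lemma vq_scaleE c x : vq_scale c (vproj x) = vproj (c *: x).
Proof.
apply/vprojP; rewrite -scalerBr -[X in W X]addr0.
by apply: smodD; [apply: vreprP|apply: smod0].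
Qed.
Lemma vq_oppE x : vq_opp (vproj x) = vproj (- x).
Proof. by rewrite -[- x]scaleN1r -vq_scaleE /vq_scale scaleN1r. Qed.

Lemma vq_addA : associative vq_add.
Proof. by move=> p q r; rewrite -[p]vreprK -[q]vreprK -[r]vreprK !vq_addE addrA. Qed.
Lemma vq_addC : commutative vq_add.
Proof. by move=> p q; rewrite -[p]vreprK -[q]vreprK !vq_addE addrC. Qed.
Lemma vq_add0 : left_id (vproj 0) vq_add.
Proof. by move=> p; rewrite -[p]vreprK !vq_addE add0r. Qed.
Lemma vq_addN : left_inverse (vproj 0) vq_opp vq_add.
Proof. by move=> p; rewrite -[p]vreprK vq_oppE vq_addE addNr. Qed.
HB.instance Definition _ := GRing.isZmodule.Build vquot vq_addA vq_addC vq_add0 vq_addN.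

Lemma vq_scaleA a b p : vq_scale a (vq_scale b p) = vq_scale (a * b) p.
Proof. by rewrite -[p]vreprK !vq_scaleE scalerA. Qed.
Lemma vq_scale1 : left_id 1 vq_scale.
Proof. by move=> p; rewrite -[p]vreprK !vq_scaleE scale1r. Qed.
Lemma vq_scaleDr : right_distributive vq_scale +%R.
Proof.
move=> a p q; rewrite -[LHS]/(vq_scale a (vq_add p q)).
rewrite -[RHS]/(vq_add (vq_scale a p) (vq_scale a q)).
by rewrite -[p]vreprK -[q]vreprK vq_addE !vq_scaleE vq_addE scalerDr.
Qed.
Lemma vq_scaleDl p : {morph vq_scale^~ p : a b / a + b}.
Proof.
move=> a b; rewrite -[RHS]/(vq_add (vq_scale a p) (vq_scale b p)).
by rewrite -[p]vreprK !vq_scaleE vq_addE scalerDl.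
Qed.
HB.instance Definition _ := GRing.Zmodule_isLmodule.Build S vquot
  vq_scaleA vq_scale1 vq_scaleDr vq_scaleDl.

Lemma vproj_linear : linear vproj.
Proof.
move=> c x y; rewrite -[RHS]/(vq_add (vq_scale c (vproj x)) (vproj y)).
by rewrite vq_scaleE vq_addE.
Qed.
Lemma vproj0 x : W x -> vproj x = 0.
Proof. by move=> Wx; apply/vprojP; rewrite subr0. Qed.
Lemma vproj_eq0 x : vproj x = 0 -> W x.
Proof. by move/vprojP; rewrite subr0. Qed.

End Quotient.
End LinearAlgebra.

Section Tensor.
Variables (S : comNzRingType) (M N : lmodType S) (K : Type).
Variables (ra : M -> K -> M) (la : K -> N -> N).

Definition tscale (c : S) (s : seq (M * N)) := [seq (c *: p.1, p.2) | p <- s].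

(* The linear congruence on formal sums of pairs that defines the tensor product
   balanced over S and over K. *)
Inductive tens_eq : seq (M * N) -> seq (M * N) -> Prop :=
| te_refl s : tens_eq s s
| te_sym s t : tens_eq s t -> tens_eq t s
| te_trans s t u : tens_eq s t -> tens_eq t u -> tens_eq s u
| te_comm s t : tens_eq (s ++ t) (t ++ s)
| te_cat s s' t t' : tens_eq s s' -> tens_eq t t' -> tens_eq (s ++ t) (s' ++ t')
| te_scale c s t : tens_eq s t -> tens_eq (tscale c s) (tscale c t)
| te_zero n : tens_eq [:: (0, n)] [::]
| te_addl m m' n : tens_eq [:: (m + m', n)] [:: (m, n); (m', n)]
| te_addr m n n' : tens_eq [:: (m, n + n')] [:: (m, n); (m, n')]
| te_scalar c m n : tens_eq [:: (c *: m, n)] [:: (m, c *: n)]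
| te_balance m k n : tens_eq [:: (ra m k, n)] [:: (m, la k n)].

Definition tequiv s t := `[< tens_eq s t >].
Lemma tequiv_refl : reflexive tequiv.
Proof. by move=> s; apply/asboolP; apply: te_refl. Qed.
Lemma tequiv_sym : symmetric tequiv.
Proof. by move=> s t; apply/asboolP/asboolP; apply: te_sym. Qed.
Lemma tequiv_trans : transitive tequiv.
Proof. by move=> t s u /asboolP st /asboolP tu; apply/asboolP/(te_trans st). Qed.
Canonical tequiv_equiv := EquivRel tequiv tequiv_refl tequiv_sym tequiv_trans.

Definition tensor := {eq_quot tequiv}.
HB.instance Definition _ := Choice.on tensor.
HB.instance Definition _ := EqQuotient.on tensor.

Definition tclass (s : seq (M * N)) : tensor := \pi_tensor s.
(* A chosen formal sum representing t *)
Definition trep (t : tensor) : seq (M * N) := repr t.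
Definition tpure (m : M) (n : N) : tensor := tclass [:: (m, n)].

Lemma trepK t : tclass (trep t) = t. Proof. exact: reprK. Qed.
Lemma tclassP s t : tclass s = tclass t <-> tens_eq s t.
Proof. by split=> [/eqquotP/asboolP//|st]; apply/eqquotP/asboolP. Qed.
Lemma trepP s : tens_eq (trep (tclass s)) s.
Proof. by apply/tclassP; rewrite trepK. Qed.

Definition tens_add (s t : tensor) := tclass (trep s ++ trep t).
Definition tens_scale c (s : tensor) := tclass (tscale c (trep s)).

Lemma tens_addE s t : tens_add (tclass s) (tclass t) = tclass (s ++ t).
Proof. by apply/tclassP/te_cat; apply: trepP. Qed.
Lemma tens_scaleE c s : tens_scale c (tclass s) = tclass (tscale c s).
Proof. by apply/tclassP/te_scale/trepP. Qed.

Lemma tens_addA : associative tens_add.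
Proof. by move=> s t u; rewrite -[s]trepK -[t]trepK -[u]trepK !tens_addE catA. Qed.
Lemma tens_addC : commutative tens_add.
Proof.
by move=> s t; rewrite -[s]trepK -[t]trepK !tens_addE; apply/tclassP/te_comm.
Qed.
Lemma tens_add0 : left_id (tclass [::]) tens_add.
Proof. by move=> s; rewrite -[s]trepK !tens_addE. Qed.

Lemma tscale_cat c s t : tscale c (s ++ t) = tscale c s ++ tscale c t.
Proof. exact: map_cat. Qed.

Lemma tens_scaleDl_pure a b m n :
  tens_eq (tscale (a + b) [:: (m, n)]) (tscale a [:: (m, n)] ++ tscale b [:: (m, n)]).
Proof. by rewrite /= scalerDl; apply: te_addl. Qed.

Lemma tens_scaleDl_seq a b s : tens_eq (tscale (a + b) s) (tscale a s ++ tscale b s).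
Proof.
elim: s => [|[m n] s IH] /=; first exact: te_refl.
apply: (te_trans (te_cat (tens_scaleDl_pure a b m n) IH)); rewrite /=.
apply: (te_cat (te_refl [:: _])).
rewrite -cat_rcons -cats1 -[_ :: _ ++ _]/(([:: (b *: m, n)] ++ _) ++ _) .
by apply: te_cat; [apply: te_comm|apply: te_refl].
Qed.

Lemma tens_scale0_seq s : tens_eq (tscale 0 s) [::].
Proof.
elim: s => [|[m n] s IH] /=; first exact: te_refl.
by rewrite scale0r; apply: (te_cat (te_zero n) IH).
Qed.

Lemma tens_addN : left_inverse (tclass [::]) (tens_scale (-1)) tens_add.
Proof.
move=> s; rewrite -[s]trepK tens_scaleE tens_addE; move: (trep s) => {}s.
have E : tscale 1 s = s by rewrite /tscale -[RHS]map_id; apply: eq_map => -[m n]; rewrite /= scale1r.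
apply/tclassP; rewrite -[X in _ ++ X]E.
apply: te_trans (te_sym (tens_scaleDl_seq _ _ _)) _.
by rewrite addNr; apply: tens_scale0_seq.
Qed.

HB.instance Definition _ := GRing.isZmodule.Build tensor
  tens_addA tens_addC tens_add0 tens_addN.

Lemma tclass_cat s t : tclass (s ++ t) = tclass s + tclass t.
Proof. by rewrite -tens_addE. Qed.

Lemma tens_scaleA a b p : tens_scale a (tens_scale b p) = tens_scale (a * b) p.
Proof.
rewrite -[p]trepK !tens_scaleE; congr tclass; rewrite /tscale -map_comp.
by apply: eq_map => -[m n]; rewrite /= scalerA.
Qed.
Lemma tens_scale1 : left_id 1 tens_scale.
Proof.
move=> p; rewrite -[p]trepK !tens_scaleE; congr tclass.
by rewrite /tscale -[RHS]map_id; apply: eq_map => -[m n]; rewrite /= scale1r.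
Qed.
Lemma tens_scaleDr : right_distributive tens_scale +%R.
Proof.
move=> a p q; rewrite -[p]trepK -[q]trepK -tclass_cat !tens_scaleE tscale_cat.
exact: tclass_cat.
Qed.
Lemma tens_scaleDl p : {morph tens_scale^~ p : a b / a + b}.
Proof.
move=> a b; rewrite -[p]trepK !tens_scaleE -tclass_cat.
exact/tclassP/tens_scaleDl_seq.
Qed.
HB.instance Definition _ := GRing.Zmodule_isLmodule.Build S tensor
  tens_scaleA tens_scale1 tens_scaleDr tens_scaleDl.

Lemma tclass_sum s : tclass s = \sum_(p <- s) tpure p.1 p.2.
Proof.
elim: s => [|[m n] s IH]; first by rewrite big_nil.
by rewrite big_cons -IH -tclass_cat.
Qed.
Lemma trep_sum t : t = \sum_(p <- trep t) tpure p.1 p.2.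
Proof. by rewrite -tclass_sum trepK. Qed.

Lemma tpureDl m m' n : tpure (m + m') n = tpure m n + tpure m' n.
Proof. by rewrite -tclass_cat; apply/tclassP/te_addl. Qed.
Lemma tpureDr m n n' : tpure m (n + n') = tpure m n + tpure m n'.
Proof. by rewrite -tclass_cat; apply/tclassP/te_addr. Qed.
Lemma tpureZl c m n : tpure (c *: m) n = c *: tpure m n.
Proof. by rewrite -[RHS]/(tens_scale _ _) tens_scaleE. Qed.
Lemma tpureZr c m n : tpure m (c *: n) = c *: tpure m n.
Proof. by rewrite -tpureZl; apply/tclassP/te_sym/te_scalar. Qed.
Lemma tpure_bal m k n : tpure (ra m k) n = tpure m (la k n).
Proof. by apply/tclassP/te_balance. Qed.
Lemma tpure_bilin : bilin tpure.
Proof. by split=> [n c x y|m c x y]; rewrite ?tpureDl ?tpureDr ?tpureZl ?tpureZr. Qed.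

Lemma tensor_ind (P : tensor -> Prop) :
  P 0 -> (forall s t, P s -> P t -> P (s + t)) -> (forall m n, P (tpure m n)) ->
  forall t, P t.
Proof.
move=> P0 PD Pp t; rewrite (trep_sum t).
by elim/big_ind: _ => // p _; apply: Pp.
Qed.

Lemma tensor_ext (V : zmodType) (f g : tensor -> V) : addf f -> addf g ->
  (forall m n, f (tpure m n) = g (tpure m n)) -> forall t, f t = g t.
Proof.
move=> fD gD fg; apply: tensor_ind => // [|s t fs ft]; first by rewrite !addf0.
by rewrite fD gD fs ft.
Qed.

Record tbalanced (V : zmodType) (b : M -> N -> V) : Prop := TBalanced {
  tb_addl : forall n, addf (b^~ n);
  tb_addr : forall m, addf (b m);
  tb_scal : forall c m n, b (c *: m) n = b m (c *: n);
  tb_bal : forall c m k n, b (c *: ra m k) n = b (c *: m) (la k n) }.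

(* The map on the tensor product induced by a balanced map b *)
Definition tlift (V : zmodType) (b : M -> N -> V) (t : tensor) : V :=
  \sum_(p <- trep t) b p.1 p.2.

Section Lift.
Variable V : zmodType.

Lemma tens_eq_lift s t : tens_eq s t -> forall b : M -> N -> V, tbalanced b ->
  \sum_(p <- s) b p.1 p.2 = \sum_(p <- t) b p.1 p.2.
Proof.
elim=> {s t} [|s t _ IH b hb|s t u _ IH1 _ IH2 b hb|s t b hb|s s' t t' _ IH1 _ IH2 b hb
  |c s t _ IH b hb|n b hb|m m' n b hb|m n n' b hb|c m n b hb|m k n b hb] //.
- by rewrite (IH b).
- by rewrite (IH1 b) // IH2.
- by rewrite !big_cat /= addrC.
- by rewrite !big_cat (IH1 b) // (IH2 b).
- rewrite !big_map; apply: (IH (fun m n => b (c *: m) n)).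
  split=> [n x y|m x y|d m n|d m k n]; first by rewrite scalerDr (tb_addl hb).
  + exact: (tb_addr hb).
  + by rewrite scalerA mulrC -scalerA (tb_scal hb).
  + by rewrite !scalerA (tb_bal hb).
- by rewrite big_seq1 big_nil /= (addf0 (tb_addl hb n)).
- by rewrite !big_cons !big_nil /= !addr0 (tb_addl hb).
- by rewrite !big_cons !big_nil /= !addr0 (tb_addr hb).
- by rewrite !big_seq1 (tb_scal hb).
- by rewrite !big_seq1 /= -[ra m k]scale1r (tb_bal hb) scale1r.
Qed.

Variable b : M -> N -> V.
Hypothesis hb : tbalanced b.

Lemma tlift_class s : tlift b (tclass s) = \sum_(p <- s) b p.1 p.2.
Proof. by apply: tens_eq_lift => //; apply: trepP. Qed.
Lemma tlift_pure m n : tlift b (tpure m n) = b m n.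
Proof. by rewrite tlift_class big_seq1. Qed.
Lemma tliftD : addf (tlift b).
Proof.
move=> s t; rewrite -[s]trepK -[t]trepK -tclass_cat !tlift_class.
by rewrite big_cat.
Qed.
Lemma tlift_tsum (I : Type) (r : seq I) (P : pred I) (f : I -> M) (g : I -> N) :
  tlift b (\sum_(i <- r | P i) tpure (f i) (g i)) = \sum_(i <- r | P i) b (f i) (g i).
Proof. by rewrite (addf_sum tliftD); apply: eq_bigr => i _; rewrite tlift_pure. Qed.
End Lift.

Lemma tlift_linear (V : lmodType S) (b : M -> N -> V) : bilin b ->
  (forall m k n, b (ra m k) n = b m (la k n)) -> (forall c m k, ra (c *: m) k = c *: ra m k) ->
  tbalanced b /\ linear (tlift b).
Proof.
move=> [bl br] bb raZ.
have bZl c m n : b (c *: m) n = c *: b m n by rewrite (linear_scal _ _ (bl n)).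
have hb : tbalanced b.
  split=> [n|m|c m n|c m k n]; [exact: linear_addf|exact: linear_addf| |].
    by rewrite bZl (linear_scal _ _ (br m)).
  by rewrite -raZ bb.
split=> // c s t; rewrite (tliftD hb); congr (_ + _).
apply: (tensor_ext (f := fun s => tlift b (c *: s)) (g := fun s => c *: tlift b s)).
- by move=> x y; rewrite scalerDr (tliftD hb).
- by move=> x y; rewrite (tliftD hb) scalerDr.
by move=> m n; rewrite -tpureZl !(tlift_pure hb) bZl.
Qed.

Lemma tlift_split (V : zmodType) (b b1 b2 : M -> N -> V) t :
  (forall m n, b m n = b1 m n + b2 m n) -> tlift b t = tlift b1 t + tlift b2 t.
Proof. by move=> bE; rewrite -big_split; apply: eq_bigr => p _; rewrite bE. Qed.

End Tensor.

(* The tensor product over S alone *)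
Notation ctensor M N :=
  (tensor (M := M) (N := N) (fun m (_ : void) => m) (fun (_ : void) n => n)).
Notation cpure m n :=
  (tpure (fun m' (_ : void) => m') (fun (_ : void) n' => n') m n).

Section Algebras.
Variable R : realDomainType.
Local Notation C := (cplx R).

Definition antilin (U V : lmodType C) (f : U -> V) :=
  forall c x y, f (c *: x + y) = cconj c *: f x + f y.

(* Not necessarily unital *)
Record starAlg := StarAlg {
  sa_car :> lmodType C;
  sa_mul : sa_car -> sa_car -> sa_car;
  sa_star : sa_car -> sa_car;
  sa_bilin : bilin sa_mul;
  sa_assoc : associative sa_mul;
  sa_antilin : antilin sa_star;
  sa_starM : forall a b, sa_star (sa_mul a b) = sa_mul (sa_star b) (sa_star a);
  sa_starK : involutive sa_star }.

Definition sa_unit (A : starAlg) (e : A) := forall a, sa_mul e a = a /\ sa_mul a e = a.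
Definition sa_idempotent (A : starAlg) :=
  forall a : A, lspan [set c | exists x y, c = sa_mul x y] a.
Definition sa_nondegenerate (A : starAlg) := forall a : A,
  ((forall b, sa_mul a b = 0) -> a = 0) /\ ((forall b, sa_mul b a = 0) -> a = 0).

Definition positive_functional (A : starAlg) (w : A -> C) :=
  (forall c x y, w (c *: x + y) = c * w x + w y) /\
  (forall a, cnneg (w (sa_mul (sa_star a) a))).
Definition positive_elt (A : starAlg) (a : A) :=
  forall w, positive_functional w -> cnneg (w a).

Section Matrices.
Variables (I : finType) (A : starAlg).
Local Notation M := {ffun I * I -> A}.
Definition mx_mul (a b : M) : M :=
  [ffun ij => \sum_k sa_mul (a (ij.1, k)) (b (k, ij.2))].
Definition mx_star (a : M) : M := [ffun ij => sa_star (a (ij.2, ij.1))].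

Lemma mx_bilin : bilin mx_mul.
Proof.
split=> [b c x y|a c x y]; apply/ffunP => ij; rewrite !ffunE scaler_sumr -big_split;
  apply: eq_bigr => k _; rewrite !ffunE.
- exact: (sa_bilin A).1.
- exact: (sa_bilin A).2.
Qed.
Lemma mx_assoc : associative mx_mul.
Proof.
move=> a b c; apply/ffunP => ij; rewrite !ffunE /=.
under eq_bigr do rewrite ffunE /= (addf_sum (linear_addf ((sa_bilin A).2 _))).
rewrite exchange_big; apply: eq_bigr => k _; rewrite ffunE /=.
rewrite (addf_sum (linear_addf ((sa_bilin A).1 (c (k, ij.2))))).
by apply: eq_bigr => l _; rewrite sa_assoc.
Qed.
Lemma mx_antilin : antilin mx_star.
Proof. by move=> c x y; apply/ffunP => ij; rewrite !ffunE sa_antilin. Qed.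
Lemma sa_star_addf : addf (@sa_star A).
Proof.
move=> x y; have E : cconj 1 = 1 :> C by apply: cconj1.
by have := sa_antilin 1 x y; rewrite E !scale1r.
Qed.
Lemma mx_starM a b : mx_star (mx_mul a b) = mx_mul (mx_star b) (mx_star a).
Proof.
apply/ffunP => ij; rewrite !ffunE /= (addf_sum sa_star_addf).
by apply: eq_bigr => k _; rewrite !ffunE sa_starM.
Qed.
Lemma mx_starK : involutive mx_star.
Proof. by move=> a; apply/ffunP => -[i j]; rewrite !ffunE sa_starK. Qed.

Definition mxalg : starAlg :=
  @StarAlg M mx_mul mx_star mx_bilin mx_assoc mx_antilin mx_starM mx_starK.
End Matrices.

Section InnerProducts.
Variables (A : starAlg) (V : lmodType C).

Record is_rmodule (ra : V -> A -> V) : Prop := {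
  rm_bilin : bilin ra;
  rm_assoc : forall x a b, ra x (sa_mul a b) = ra (ra x a) b;
  rm_unit : forall e, sa_unit e -> forall x, ra x e = x }.

Record is_lmodule (la : A -> V -> V) : Prop := {
  lm_bilin : bilin la;
  lm_assoc : forall x a b, la (sa_mul a b) x = la a (la b x);
  lm_unit : forall e, sa_unit e -> forall x, la e x = x }.

(* Right-linear inner products, linear in the second argument *)
Record is_rip (ra : V -> A -> V) (ip : V -> V -> A) : Prop := {
  rip_lin : forall x, linear (ip x);
  rip_antilin : forall y, antilin (ip^~ y);
  rip_act : forall x y a, ip x (ra y a) = sa_mul (ip x y) a;
  rip_star : forall x y, ip x y = sa_star (ip y x) }.

(* Left-linear inner products, linear in the first argument *)
Record is_lip (la : A -> V -> V) (ip : V -> V -> A) : Prop := {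
  lip_lin : forall y, linear (ip^~ y);
  lip_antilin : forall x, antilin (ip x);
  lip_act : forall x y a, ip (la a x) y = sa_mul a (ip x y);
  lip_star : forall x y, ip x y = sa_star (ip y x) }.

Definition ip_nondegenerate (ip : V -> V -> A) :=
  forall x, (forall y, ip x y = 0) -> x = 0.
Definition ip_full (ip : V -> V -> A) :=
  forall a, lspan [set c | exists x y, c = ip x y] a.
Definition ip_cpos (ip : V -> V -> A) := forall (n : nat) (x : 'I_n -> V),
  @positive_elt (mxalg 'I_n A) [ffun ij => ip (x ij.1) (x ij.2)].

End InnerProducts.

Record preHilbert (D : starAlg) := PreHilbert {
  ph_car :> lmodType C;
  ph_act : ph_car -> D -> ph_car;
  ph_ip : ph_car -> ph_car -> D;
  ph_rmodule : is_rmodule ph_act;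
  ph_rip : is_rip ph_act ph_ip;
  ph_nondeg : ip_nondegenerate ph_ip;
  ph_cpos : ip_cpos ph_ip }.

Definition admissible (D : starAlg) :=
  forall (X : preHilbert D) (x : X), ph_ip x x = 0 -> x = 0.

(* A sum over p in trep (Delta g) is the sum in Sweedler notation with
   g_(1) = p.1 and g_(2) = p.2. *)
Record hopfStarAlg := HopfStarAlg {
  ho_alg :> starAlg;
  ho_one : ho_alg;
  ho_unit : sa_unit ho_one;
  Delta : {linear ho_alg -> ctensor ho_alg ho_alg};
  counit : {scalar ho_alg};
  antipode : {linear ho_alg -> ho_alg};
  ho_coassoc : forall g,
    \sum_(p <- trep (Delta g)) \sum_(q <- trep (Delta p.1))
      cpure q.1 (cpure q.2 p.2) =
    \sum_(p <- trep (Delta g)) cpure p.1 (Delta p.2);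
  ho_counitl : forall g, \sum_(p <- trep (Delta g)) counit p.1 *: p.2 = g;
  ho_counitr : forall g, \sum_(p <- trep (Delta g)) counit p.2 *: p.1 = g;
  ho_DeltaM : forall g h, Delta (sa_mul g h) =
    \sum_(p <- trep (Delta g)) \sum_(q <- trep (Delta h))
      cpure (sa_mul p.1 q.1) (sa_mul p.2 q.2);
  ho_Delta1 : Delta ho_one = cpure ho_one ho_one;
  ho_counitM : forall g h, counit (sa_mul g h) = counit g * counit h;
  ho_counit1 : counit ho_one = 1;
  ho_antipodel : forall g,
    \sum_(p <- trep (Delta g)) sa_mul (antipode p.1) p.2 = counit g *: ho_one;
  ho_antipoder : forall g,
    \sum_(p <- trep (Delta g)) sa_mul p.1 (antipode p.2) = counit g *: ho_one;
  ho_Delta_star : forall g, Delta (sa_star g) =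
    \sum_(p <- trep (Delta g)) cpure (sa_star p.1) (sa_star p.2);
  ho_counit_star : forall g, counit (sa_star g) = cconj (counit g);
  ho_antipode_star : forall g, sa_star (antipode (sa_star (antipode g))) = g }.

Definition sw (H : hopfStarAlg) (g : H) : seq (H * H) := trep (Delta H g).

Section Covariance.
Variable H : hopfStarAlg.
Local Notation S g := (antipode H g).

Record is_hmodule (V : lmodType C) (act : H -> V -> V) : Prop := {
  hm_bilin : bilin act;
  hm_assoc : forall g h x, act (sa_mul g h) x = act g (act h x);
  hm_one : forall x, act (ho_one H) x = x }.

Record hstarAlg := HStarAlg {
  ha_alg :> starAlg;
  ha_act : H -> ha_alg -> ha_alg;
  ha_hmodule : is_hmodule ha_act;
  ha_mul : forall g a b, ha_act g (sa_mul a b) =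
    \sum_(p <- sw g) sa_mul (ha_act p.1 a) (ha_act p.2 b);
  ha_star : forall g a, sa_star (ha_act g a) = ha_act (sa_star (S g)) (sa_star a);
  ha_unit : forall e : ha_alg, sa_unit e -> forall g, ha_act g e = counit H g *: e }.

Definition rip_covariant (A : hstarAlg) (V : lmodType C) (act : H -> V -> V)
    (ip : V -> V -> A) := forall g x y,
  ha_act g (ip x y) = \sum_(p <- sw g) ip (act (sa_star (S p.1)) x) (act p.2 y).
Definition lip_covariant (A : hstarAlg) (V : lmodType C) (act : H -> V -> V)
    (ip : V -> V -> A) := forall g x y,
  ha_act g (ip x y) = \sum_(p <- sw g) ip (act p.1 x) (act (sa_star (S p.2)) y).

Record hpreHilbert (D : hstarAlg) := HPreHilbert {
  hp_ph :> preHilbert D;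
  hp_act : H -> hp_ph -> hp_ph;
  hp_hmodule : is_hmodule hp_act;
  hp_cov : rip_covariant hp_act (@ph_ip D hp_ph) }.

(* H-covariant *-representations. By hr_adj every pi a is adjointable with
   adjoint pi a^*; adjointable operators on a pre-Hilbert module are
   automatically C- and D-linear. *)
Record hrep (A D : hstarAlg) := HRep {
  hr_ph :> hpreHilbert D;
  hr_pi : A -> hr_ph -> hr_ph;
  hr_lin : forall x, linear (hr_pi^~ x);
  hr_mul : forall a b x, hr_pi (sa_mul a b) x = hr_pi a (hr_pi b x);
  hr_adj : forall a x y, ph_ip x (hr_pi a y) = ph_ip (hr_pi (sa_star a) x) y;
  hr_cov : forall g a x, hr_pi (ha_act g a) x =
    \sum_(p <- sw g) hp_act p.1 (hr_pi a (hp_act (S p.2) x)) }.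

(* H-covariant strong Morita equivalence (B, A)-bimodules *)
Record equivBimod (B A : hstarAlg) := EquivBimod {
  eb_car :> lmodType C;
  eb_la : B -> eb_car -> eb_car;
  eb_ra : eb_car -> A -> eb_car;
  eb_lip : eb_car -> eb_car -> B;
  eb_rip : eb_car -> eb_car -> A;
  eb_act : H -> eb_car -> eb_car;
  eb_lmodule : is_lmodule eb_la;
  eb_rmodule : is_rmodule eb_ra;
  eb_assoc : forall b x a, eb_ra (eb_la b x) a = eb_la b (eb_ra x a);
  eb_lspan : forall x, lspan [set z | exists b y, z = eb_la b y] x;
  eb_rspan : forall x, lspan [set z | exists y a, z = eb_ra y a] x;
  eb_is_lip : is_lip eb_la eb_lip;
  eb_is_rip : is_rip eb_ra eb_rip;
  eb_lfull : ip_full eb_lip;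
  eb_rfull : ip_full eb_rip;
  eb_lnondeg : ip_nondegenerate eb_lip;
  eb_rnondeg : ip_nondegenerate eb_rip;
  eb_lcpos : ip_cpos eb_lip;
  eb_rcpos : ip_cpos eb_rip;
  eb_radj : forall b x y, eb_rip (eb_la b x) y = eb_rip x (eb_la (sa_star b) y);
  eb_ladj : forall a x y, eb_lip (eb_ra x a) y = eb_lip x (eb_ra y (sa_star a));
  eb_compat : forall x y z, eb_la (eb_lip x y) z = eb_ra x (eb_rip y z);
  eb_hmodule : is_hmodule eb_act;
  eb_rcov : rip_covariant eb_act eb_rip;
  eb_lcov : lip_covariant eb_act eb_lip }.

Record ebimod_iso (B A : hstarAlg) (E F : equivBimod B A) (f : E -> F) : Prop := {
  ei_lin : linear f;
  ei_bij : bijective f;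
  ei_la : forall b x, f (eb_la b x) = eb_la b (f x);
  ei_ra : forall x a, f (eb_ra x a) = eb_ra (f x) a;
  ei_lip : forall x y, eb_lip (f x) (f y) = eb_lip x y;
  ei_rip : forall x y, eb_rip (f x) (f y) = eb_rip x y;
  ei_act : forall g x, f (eb_act g x) = eb_act g (f x) }.

Definition ebimod_isomorphic (B A : hstarAlg) (E F : equivBimod B A) :=
  exists f : E -> F, ebimod_iso f.

(* The objects of the Picard groupoid *)
Record picObj := PicObj {
  po_alg :> hstarAlg;
  po_idem : sa_idempotent po_alg;
  po_nondeg : sa_nondegenerate po_alg }.

End Covariance.
End Algebras.

Section HopfLemmas.
Variables (R : realDomainType) (H : hopfStarAlg R).
Local Notation C := (cplx R).
Local Notation S g := (antipode H g).
Local Notation "g ** h" := (sa_mul g h) (at level 40, left associativity).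
Local Notation "g ^#" := (sa_star g) (at level 2, format "g ^#").

Lemma mulDl (A : starAlg R) (a b c : A) : (a + b) ** c = a ** c + b ** c.
Proof. exact: linear_addf ((sa_bilin A).1 _) _ _. Qed.
Lemma mulDr (A : starAlg R) (a b c : A) : a ** (b + c) = a ** b + a ** c.
Proof. exact: linear_addf ((sa_bilin A).2 _) _ _. Qed.
Lemma mulZl (A : starAlg R) c (a b : A) : (c *: a) ** b = c *: (a ** b).
Proof. exact: linear_scal ((sa_bilin A).1 _). Qed.
Lemma mulZr (A : starAlg R) c (a b : A) : a ** (c *: b) = c *: (a ** b).
Proof. exact: linear_scal ((sa_bilin A).2 _). Qed.
Lemma mul0l (A : starAlg R) (a : A) : 0 ** a = 0.
Proof. exact: (addf0 (f := fun x => x ** a) (fun x y => mulDl x y a)). Qed.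
Lemma mul0r' (A : starAlg R) (a : A) : a ** 0 = 0.
Proof. exact: (addf0 (f := fun x => a ** x) (mulDr a)). Qed.
Lemma antilin_addf (U V : lmodType C) (f : U -> V) : antilin f -> addf f.
Proof. by move=> fa x y; have := fa 1 x y; rewrite cconj1 !scale1r. Qed.
Lemma antilin_scal (U V : lmodType C) (f : U -> V) c x :
  antilin f -> f (c *: x) = cconj c *: f x.
Proof. by move=> fa; rewrite -[c *: x]addr0 fa (addf0 (antilin_addf fa)) addr0. Qed.
Lemma starD (A : starAlg R) (a b : A) : (a + b)^# = a^# + b^#.
Proof. exact: sa_star_addf. Qed.
Lemma starZ (A : starAlg R) c (a : A) : (c *: a)^# = cconj c *: a^#.
Proof. exact: antilin_scal (@sa_antilin _ A). Qed.
Lemma star0 (A : starAlg R) : (0 : A)^# = 0.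
Proof. exact: addf0 (@sa_star_addf _ A). Qed.
Lemma star_one : (ho_one H)^# = ho_one H.
Proof.
have h := (ho_unit (ho_one H)^#).1.
by have := congr1 (@sa_star _ _) h; rewrite sa_starM sa_starK h.
Qed.

Definition hbal2 (V : zmodType) (b : H -> H -> V) := [/\ forall h, addf (b^~ h),
  forall g, addf (b g) & forall c g h, b (c *: g) h = b g (c *: h)].
Definition hbal3 (V : zmodType) (b : H -> H -> H -> V) :=
  [/\ forall h k, addf (fun g => b g h k), forall g k, addf (fun h => b g h k),
   forall g h, addf (b g h), forall c g h k, b (c *: g) h k = b g (c *: h) k &
   forall c g h k, b g (c *: h) k = b g h (c *: k)].

Lemma hbal2_tb (V : zmodType) (b : H -> H -> V) : hbal2 b ->
  tbalanced (fun m (_ : void) => m) (fun (_ : void) n => n) b.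
Proof. by case=> b1 b2 b3; split=> // ? ? []. Qed.

Section Sums.
Variables (V : zmodType).

Lemma sw_mul (b : H -> H -> V) g h : hbal2 b ->
  \sum_(p <- sw (g ** h)) b p.1 p.2 =
  \sum_(p <- sw g) \sum_(q <- sw h) b (p.1 ** q.1) (p.2 ** q.2).
Proof.
move=> /hbal2_tb hb; rewrite /sw -[LHS]/(tlift _ _) ho_DeltaM.
by rewrite (addf_sum (tliftD hb)); apply: eq_bigr => p _; rewrite tlift_tsum.
Qed.
Lemma sw_one (b : H -> H -> V) : hbal2 b ->
  \sum_(p <- sw (ho_one H)) b p.1 p.2 = b (ho_one H) (ho_one H).
Proof. by move=> /hbal2_tb hb; rewrite /sw -[LHS]/(tlift _ _) ho_Delta1 tlift_pure. Qed.
Lemma sw_star (b : H -> H -> V) g : hbal2 b ->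
  \sum_(p <- sw g^#) b p.1 p.2 = \sum_(p <- sw g) b p.1^# p.2^#.
Proof. by move=> /hbal2_tb hb; rewrite /sw -[LHS]/(tlift _ _) ho_Delta_star tlift_tsum. Qed.
Lemma sw_add (b : H -> H -> V) g h : hbal2 b ->
  \sum_(p <- sw (g + h)) b p.1 p.2 =
  \sum_(p <- sw g) b p.1 p.2 + \sum_(p <- sw h) b p.1 p.2.
Proof. by move=> /hbal2_tb hb; rewrite /sw linearD; apply: tliftD. Qed.
Lemma sw_scale (b : H -> H -> V) c g : hbal2 b ->
  \sum_(p <- sw (c *: g)) b p.1 p.2 = \sum_(p <- sw g) b (c *: p.1) p.2.
Proof.
move=> /hbal2_tb hb; rewrite /sw linearZ /= {1}(trep_sum (Delta H g)) scaler_sumr.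
rewrite -[LHS]/(tlift _ _) (addf_sum (tliftD hb)).
by apply: eq_bigr => p _; rewrite -tpureZl tlift_pure.
Qed.
Lemma sw_counitl (f : H -> V) g : addf f ->
  \sum_(p <- sw g) f (counit H p.1 *: p.2) = f g.
Proof. by move=> fD; rewrite -(addf_sum fD) ho_counitl. Qed.
Lemma sw_counitr (f : H -> V) g : addf f ->
  \sum_(p <- sw g) f (counit H p.2 *: p.1) = f g.
Proof. by move=> fD; rewrite -(addf_sum fD) ho_counitr. Qed.

Lemma sw_coassoc (b : H -> H -> H -> V) g : hbal3 b ->
  \sum_(p <- sw g) \sum_(q <- sw p.1) b q.1 q.2 p.2 =
  \sum_(p <- sw g) \sum_(q <- sw p.2) b p.1 q.1 q.2.
Proof.
case=> b1 b2 b3 b12 b23.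
have hb x : tbalanced (fun m (_ : void) => m) (fun (_ : void) n => n) (b x).
  by apply: hbal2_tb; split=> *; [apply: b2|apply: b3|apply: b23].
pose B (x : H) (t : ctensor H H) := tlift (b x) t.
have hB : tbalanced (M := H) (N := ctensor H H)
    (fun m (_ : void) => m) (fun (_ : void) n => n) B.
  split=> [t x y|x|c x t|? ? []]; first by apply: tlift_split => *; apply: b1.
    exact: tliftD.
  apply: (tensor_ext (f := fun t => tlift (b (c *: x)) t)
    (g := fun t => tlift (b x) (c *: t))).
  - exact: tliftD.
  - by move=> ? ?; rewrite scalerDr tliftD.
  by move=> m n; rewrite -tpureZl !tlift_pure // b12.
have := congr1 (tlift B) (ho_coassoc g).
rewrite (addf_sum (tliftD hB)) (tlift_tsum hB) => E.
rewrite -[RHS]E; apply: eq_bigr => p _; rewrite (tlift_tsum hB).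
by apply: eq_bigr => q _; rewrite /B tlift_pure.
Qed.
End Sums.

Lemma hm_addl (V : lmodType C) (act : H -> V -> V) x : is_hmodule act -> addf (act^~ x).
Proof. by move=> /hm_bilin[h _]; apply: linear_addf. Qed.
Lemma hm_addr (V : lmodType C) (act : H -> V -> V) g : is_hmodule act -> addf (act g).
Proof. by move=> /hm_bilin[_ h]; apply: linear_addf. Qed.
Lemma hm_scall (V : lmodType C) (act : H -> V -> V) c g x : is_hmodule act ->
  act (c *: g) x = c *: act g x.
Proof. by move=> /hm_bilin[h _]; rewrite (linear_scal _ _ (h x)). Qed.
Lemma hm_scalr (V : lmodType C) (act : H -> V -> V) c g x : is_hmodule act ->
  act g (c *: x) = c *: act g x.
Proof. by move=> /hm_bilin[_ h]; rewrite (linear_scal _ _ (h g)). Qed.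

Section RightCovariance.
Variables (A : hstarAlg H) (V : lmodType C) (act : H -> V -> V) (ip : V -> V -> A).
Hypothesis hm : is_hmodule act.
Hypothesis ipl : forall x, linear (ip x).
Hypothesis ipa : forall y, antilin (ip^~ y).

(* The antipode-free form of covariance *)
Definition rip_cov' := forall g x y,
  ip x (act g y) = \sum_(p <- sw g) ha_act p.2 (ip (act p.1^# x) y).

Let ipD1 y : addf (ip^~ y) := antilin_addf (ipa y).
Let ipD2 x : addf (ip x) := linear_addf (ipl x).
Let ipZ1 c x y : ip (c *: x) y = cconj c *: ip x y := antilin_scal c x (ipa y).
Let ipZ2 c x y : ip x (c *: y) = c *: ip x y := linear_scal c y (ipl x).

Lemma rip_covP : rip_covariant act ip <-> rip_cov'.
Proof.
have hA := ha_hmodule A; split=> cov g x y.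
- under eq_bigr do rewrite cov.
  under eq_bigr do under eq_bigr do rewrite -(hm_assoc hm) -sa_starM.
  rewrite -(sw_coassoc (b := fun a b c => ip (act (a ** S b)^# x) (act c y))).
    transitivity (\sum_(p <- sw g) ip x (act (counit H p.1 *: p.2) y)).
      by rewrite (sw_counitl (f := fun h => ip x (act h y))) // => a b; rewrite (hm_addl _ hm) ipD2.
    apply: eq_bigr => p _.
    rewrite -(addf_sum (f := fun h => ip (act h^# x) (act p.2 y))); last first.
      by move=> a b; rewrite starD (hm_addl _ hm) ipD1.
    rewrite ho_antipoder starZ star_one !(hm_scall _ _ _ hm) (hm_one hm).
    by rewrite ipZ1 ipZ2 cconjK.
  split=> *; rewrite /addf => *; rewrite ?linearD ?linearZ ?(mulDl, mulDr) ?(mulZl, mulZr) /= ?(starD, starZ).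
  + by rewrite (hm_addl _ hm) ipD1.
  + by rewrite (hm_addl _ hm) ipD1.
  + by rewrite (hm_addl _ hm) ipD2.
  + by [].
  + by rewrite !(hm_scall _ _ _ hm) ipZ1 ipZ2 cconjK.
- under eq_bigr do rewrite cov.
  under eq_bigr do under eq_bigr do rewrite -(hm_assoc hm) -sa_starM.
  rewrite -(sw_coassoc (b := fun a b c => ha_act c (ip (act (S a ** b)^# x) y))).
    transitivity (\sum_(p <- sw g) ha_act (counit H p.1 *: p.2) (ip x y)).
      by rewrite (sw_counitl (f := fun h => ha_act h (ip x y))) // => a b; rewrite (hm_addl _ hA).
    apply: eq_bigr => p _.
    rewrite -(addf_sum (f := fun h => ha_act p.2 (ip (act h^# x) y))); last first.
      by move=> a b; rewrite starD (hm_addl _ hm) ipD1 (hm_addr _ hA).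
    rewrite ho_antipodel starZ star_one !(hm_scall _ _ _ hm) (hm_one hm).
    by rewrite ipZ1 (hm_scalr _ _ _ hA) (hm_scall _ _ _ hA) cconjK.
  split=> *; rewrite /addf => *; rewrite ?linearD ?linearZ /= ?(mulDl, mulDr) ?(mulZl, mulZr) ?(starD, starZ).
  + by rewrite (hm_addl _ hm) ipD1 (hm_addr _ hA).
  + by rewrite (hm_addl _ hm) ipD1 (hm_addr _ hA).
  + by rewrite (hm_addl _ hA).
  + by [].
  + by rewrite !(hm_scall _ _ _ hm, hm_scall _ _ _ hA) ipZ1 (hm_scalr _ _ _ hA) cconjK.
Qed.

End RightCovariance.

Section Modules.
Variables (A : hstarAlg H) (X : hpreHilbert A).
Local Notation ip := (@ph_ip _ _ X).

Lemma ph_ipD1 y : addf (fun x => ip x y).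
Proof. exact: antilin_addf (rip_antilin (ph_rip X) y). Qed.
Lemma ph_ipD2 x : addf (ip x).
Proof. exact: linear_addf (rip_lin (ph_rip X) x). Qed.
Lemma ph_ipZ1 c x y : ip (c *: x) y = cconj c *: ip x y.
Proof. exact: antilin_scal (rip_antilin (ph_rip X) y). Qed.
Lemma ph_ipZ2 c x y : ip x (c *: y) = c *: ip x y.
Proof. exact: linear_scal (rip_lin (ph_rip X) x). Qed.
Lemma ph_ext x y : (forall z, ip z x = ip z y) -> x = y.
Proof.
move=> E; apply/eqP; rewrite -subr_eq0; apply/eqP/(ph_nondeg (p := X)) => z.
by rewrite (rip_star (ph_rip X)) (addfB (ph_ipD2 _)) E subrr star0.
Qed.
Lemma hp_cov' : rip_cov' (@hp_act _ _ _ X) ip.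
Proof.
apply/rip_covP; first exact: hp_hmodule.
- exact: rip_lin (ph_rip X).
- exact: rip_antilin (ph_rip X).
- exact: hp_cov.
Qed.
Lemma ph_actD1 a : addf (fun x : X => ph_act x a).
Proof. exact: linear_addf ((rm_bilin (ph_rmodule X)).1 a). Qed.
Lemma ph_actD2 (x : X) : addf (ph_act x).
Proof. exact: linear_addf ((rm_bilin (ph_rmodule X)).2 x). Qed.
Lemma ph_actZ1 c (x : X) a : ph_act (c *: x) a = c *: ph_act x a.
Proof. exact: linear_scal ((rm_bilin (ph_rmodule X)).1 a). Qed.
Lemma ph_actZ2 c (x : X) a : ph_act x (c *: a) = c *: ph_act x a.
Proof. exact: linear_scal ((rm_bilin (ph_rmodule X)).2 x). Qed.

Lemma hp_act_mod g (x : X) a :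
  hp_act g (ph_act x a) = \sum_(p <- sw g) ph_act (hp_act p.1 x) (ha_act p.2 a).
Proof.
have hm := hp_hmodule X; have hA := ha_hmodule A.
apply: ph_ext => z; rewrite hp_cov' (addf_sum (ph_ipD2 _)).
under eq_bigr do rewrite (rip_act (ph_rip X)) ha_mul.
under [RHS]eq_bigr do rewrite (rip_act (ph_rip X)) hp_cov'.
rewrite -(sw_coassoc (b := fun h k l => ha_act k (ip (hp_act h^# z) x) ** ha_act l a)).
  apply: eq_bigr => p _; symmetry.
  by apply: (addf_sum (f := fun b => b ** _)) => ? ?; apply: mulDl.
split=> *; rewrite /addf => *; rewrite ?(starD, starZ) ?(hm_addl _ hm, hm_scall _ _ _ hm)
  ?(ph_ipD1, ph_ipZ1) ?(hm_addl _ hA, hm_addr _ hA, hm_scall _ _ _ hA, hm_scalr _ _ _ hA)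
  ?(mulDl, mulDr, mulZl, mulZr) //.
by rewrite cconjK.
Qed.

End Modules.

Section Reps.
Variables (A D : hstarAlg H) (X : hrep A D).
Local Notation pi := (@hr_pi _ _ _ _ X).

Lemma hr_D1 x : addf (fun a => pi a x).
Proof. exact: linear_addf (hr_lin (h := X) x). Qed.
Lemma hr_Z1 c a x : pi (c *: a) x = c *: pi a x.
Proof. exact: linear_scal (hr_lin (h := X) x). Qed.
Lemma hr_D2 a : addf (pi a).
Proof.
move=> x y; apply: ph_ext => z; rewrite ph_ipD2 !hr_adj.
by rewrite ph_ipD2.
Qed.
Lemma hr_Z2 c a x : pi a (c *: x) = c *: pi a x.
Proof. by apply: ph_ext => z; rewrite ph_ipZ2 !hr_adj ph_ipZ2. Qed.
Lemma hr_act a x d : pi a (ph_act x d) = ph_act (pi a x) d.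
Proof.
have r := ph_rip X.
by apply: ph_ext => z; rewrite hr_adj !(rip_act r) hr_adj.
Qed.
Lemma hr_mod g a x :
  hp_act g (pi a x) = \sum_(p <- sw g) pi (ha_act p.1 a) (hp_act p.2 x).
Proof.
have hm := hp_hmodule X.
under eq_bigr do rewrite hr_cov.
under eq_bigr do under eq_bigr do rewrite -(hm_assoc hm).
rewrite (sw_coassoc (b := fun h k l => hp_act h (pi a (hp_act (S k ** l) x)))).
  rewrite -[LHS](sw_counitr (f := fun g => hp_act g (pi a x))); last first.
    by move=> ? ?; rewrite (hm_addl _ hm).
  apply: eq_bigr => p _.
  rewrite -(addf_sum (f := fun h => hp_act p.1 (pi a (hp_act h x)))); last first.
    by move=> ? ?; rewrite (hm_addl _ hm) hr_D2 (hm_addr _ hm).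
  rewrite ho_antipodel !(hm_scall _ _ _ hm) (hm_one hm).
  by rewrite hr_Z2 (hm_scalr _ _ _ hm).
split=> *; rewrite /addf => *; rewrite ?linearD ?linearZ /= ?(mulDl, mulDr, mulZl, mulZr)
  ?(hm_addl _ hm, hm_scall _ _ _ hm) ?(hr_D2, hr_Z2) ?(hm_addr _ hm, hm_scalr _ _ _ hm) //.
Qed.

End Reps.
End HopfLemmas.

Section DegeneracyQuotient.
Variables (R : realDomainType) (H : hopfStarAlg R).
Local Notation C := (cplx R).
Local Notation "g ** h" := (sa_mul g h) (at level 40, left associativity).
Local Notation "g ^#" := (sa_star g) (at level 2, format "g ^#").

(* H-covariant inner product modules, possibly degenerate *)
Record hipMod (D : hstarAlg H) := HipMod {
  im_car :> lmodType C;
  im_ra : im_car -> D -> im_car;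
  im_ip : im_car -> im_car -> D;
  im_act : H -> im_car -> im_car;
  im_rmodule : is_rmodule im_ra;
  im_rip : is_rip im_ra im_ip;
  im_cpos : ip_cpos im_ip;
  im_hmodule : is_hmodule im_act;
  im_cov : rip_covariant im_act im_ip }.

Variables (D : hstarAlg H) (V : hipMod D).
Local Notation ip := (@im_ip D V).

Lemma im_ipD1 y : addf (fun x => ip x y).
Proof. exact: antilin_addf (rip_antilin (im_rip V) y). Qed.
Lemma im_ipD2 x : addf (ip x).
Proof. exact: linear_addf (rip_lin (im_rip V) x). Qed.
Lemma im_cov' : rip_cov' (@im_act _ V) ip.
Proof.
apply/rip_covP; first exact: im_hmodule.
- exact: rip_lin (im_rip V).
- exact: rip_antilin (im_rip V).
- exact: im_cov.
Qed.

Lemma degen0 y : ip 0 y = 0. Proof. exact: (addf0 (im_ipD1 y)). Qed.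
Lemma degenD c x y : (forall z, ip x z = 0) -> (forall z, ip y z = 0) ->
  forall z, ip (c *: x + y) z = 0.
Proof. by move=> x0 y0 z; rewrite (rip_antilin (im_rip V)) x0 y0 scaler0 addr0. Qed.

Definition degen : submodule V :=
  @Submodule _ V (fun x => forall y, ip x y = 0) degen0 degenD.

Lemma degenP x : degen x <-> forall y, ip y x = 0.
Proof. by split=> h y; rewrite (rip_star (im_rip V)) h star0. Qed.

Definition dq := vquot degen.
Local Notation "⟦ x ⟧" := (vproj degen x).
Definition dq_ra (q : dq) d : dq := ⟦ im_ra (vrepr q) d ⟧.
Definition dq_ip (q r : dq) := ip (vrepr q) (vrepr r).
Definition dq_act g (q : dq) : dq := ⟦ im_act g (vrepr q) ⟧.

Lemma dq_eq x y : (forall z, ip z x = ip z y) -> ⟦ x ⟧ = ⟦ y ⟧.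
Proof.
move=> E; apply/vprojP/degenP => z.
by rewrite (addfB (im_ipD2 z)) E subrr.
Qed.
Lemma dq_eqP x y : ⟦ x ⟧ = ⟦ y ⟧ -> forall z, ip z x = ip z y.
Proof.
move=> /vprojP/degenP E z; apply/eqP; rewrite -subr_eq0; apply/eqP.
by rewrite -(addfB (im_ipD2 z)).
Qed.

(* Adjointable maps descend *)
Definition dq_map (f : V -> V) (q : dq) : dq := ⟦ f (vrepr q) ⟧.
Lemma dq_mapE (f f' : V -> V) x :
  (forall z y, ip z (f y) = ip (f' z) y) -> dq_map f ⟦ x ⟧ = ⟦ f x ⟧.
Proof.
move=> adj; apply: dq_eq => z; rewrite !adj.
by apply: dq_eqP; rewrite vreprK.
Qed.

Lemma dq_ipE x y : dq_ip ⟦ x ⟧ ⟦ y ⟧ = ip x y.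
Proof.
rewrite /dq_ip (dq_eqP (vreprK ⟦ y ⟧)) (rip_star (im_rip V)).
by rewrite (dq_eqP (vreprK ⟦ x ⟧)) -(rip_star (im_rip V)).
Qed.
Lemma dq_raE x d : dq_ra ⟦ x ⟧ d = ⟦ im_ra x d ⟧.
Proof.
apply: dq_eq => z; rewrite !(rip_act (im_rip V)); congr (_ ** _).
by apply: dq_eqP; rewrite vreprK.
Qed.
Lemma dq_actE g x : dq_act g ⟦ x ⟧ = ⟦ im_act g x ⟧.
Proof.
apply: dq_eq => z; rewrite !im_cov'; apply: eq_bigr => p _; congr ha_act.
by apply: dq_eqP; rewrite vreprK.
Qed.

Lemma vprojZD c x y : c *: ⟦ x ⟧ + ⟦ y ⟧ = ⟦ c *: x + y ⟧.
Proof. by rewrite vproj_linear. Qed.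
Lemma vprojD x y : ⟦ x ⟧ + ⟦ y ⟧ = ⟦ x + y ⟧.
Proof. by rewrite -[x]scale1r -vprojZD !scale1r. Qed.
Lemma vproj_addf : addf (vproj degen).
Proof. by move=> x y; rewrite vprojD. Qed.

Lemma dq_rmodule : is_rmodule dq_ra.
Proof.
have r := im_rmodule V; split.
- split=> [d c p q|p c d e].
    rewrite -[p]vreprK -[q]vreprK vprojZD !dq_raE vprojZD; congr vproj.
    exact: (rm_bilin r).1.
  rewrite -[p]vreprK !dq_raE vprojZD; congr vproj; exact: (rm_bilin r).2.
- by move=> p a b; rewrite -[p]vreprK !dq_raE (rm_assoc r).
- by move=> e he p; rewrite -[p]vreprK !dq_raE (rm_unit r).
Qed.
Lemma dq_rip : is_rip dq_ra dq_ip.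
Proof.
have r := im_rip V; split.
- move=> q c x y; rewrite -[q]vreprK -[x]vreprK -[y]vreprK vprojZD !dq_ipE.
  exact: (rip_lin r).
- move=> q c x y; rewrite -[q]vreprK -[x]vreprK -[y]vreprK vprojZD !dq_ipE.
  exact: (rip_antilin r).
- by move=> x y a; rewrite -[x]vreprK -[y]vreprK !dq_raE !dq_ipE (rip_act r).
- by move=> x y; apply: (rip_star r).
Qed.
Lemma dq_nondeg : ip_nondegenerate dq_ip.
Proof.
move=> q h; rewrite -[q]vreprK; apply: vproj0 => y.
by rewrite -dq_ipE vreprK h.
Qed.
Lemma dq_cpos : ip_cpos dq_ip.
Proof. by move=> n x; exact: (@im_cpos _ V n (fun i => vrepr (x i))). Qed.
Lemma dq_hmodule : is_hmodule dq_act.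
Proof.
have m := im_hmodule V; split.
- split=> [q c g h|g c p q].
    rewrite -[q]vreprK !dq_actE vprojZD; congr vproj; exact: (hm_bilin m).1.
  rewrite -[p]vreprK -[q]vreprK vprojZD !dq_actE vprojZD; congr vproj.
  exact: (hm_bilin m).2.
- by move=> g h p; rewrite -[p]vreprK !dq_actE (hm_assoc m).
- by move=> p; rewrite -[p]vreprK !dq_actE (hm_one m).
Qed.
Lemma dq_cov : rip_covariant dq_act dq_ip.
Proof.
move=> g x y; rewrite -[x]vreprK -[y]vreprK dq_ipE im_cov.
by apply: eq_bigr => p _; rewrite !dq_actE dq_ipE.
Qed.

Definition dquot : hpreHilbert D :=
  @HPreHilbert _ _ D (@PreHilbert _ D dq dq_ra dq_ip dq_rmodule dq_rip dq_nondeg dq_cpos)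
    dq_act dq_hmodule dq_cov.
End DegeneracyQuotient.

Section CPos.
Variables (R : realDomainType) (A : starAlg R) (V : lmodType (cplx R)).
Local Notation C := (cplx R).

Lemma pf_sum (B : starAlg R) (w : B -> C) (I : Type) (r : seq I) (f : I -> B) :
  positive_functional w -> (forall i, cnneg (w (f i))) -> cnneg (w (\sum_(i <- r) f i)).
Proof.
move=> [wl _] fp.
have w0 : w 0 = 0 by have := wl (-1) 0 0; rewrite scaler0 addr0 mulN1r addNr.
elim: r => [|i r IH]; first by rewrite big_nil w0 cnneg0.
by rewrite big_cons -[f i]scale1r wl mul1r cnnegD.
Qed.

Lemma cpos_fin (ip : V -> V -> A) (I : finType) (x : I -> V) : ip_cpos ip ->
  @positive_elt _ (mxalg I A) [ffun ij => ip (x ij.1) (x ij.2)].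
Proof.
move=> cp w [wl wp].
pose f (b : mxalg 'I_#|I| A) : mxalg I A :=
  [ffun ij : I * I => b (enum_rank ij.1, enum_rank ij.2)].
have := cp #|I| (fun k => x (enum_val k)) (fun b => w (f b)).
have -> : f [ffun ij => ip (x (enum_val ij.1)) (x (enum_val ij.2))] =
    [ffun ij => ip (x ij.1) (x ij.2)].
  by apply/ffunP => -[i j]; rewrite !ffunE /= !enum_rankK.
apply; split=> [c a b|a].
  by rewrite -wl; congr w; apply/ffunP => ij; rewrite !ffunE.
suff -> : f (sa_mul (sa_star a) a) = sa_mul (sa_star (f a)) (f a) by [].
apply/ffunP => -[i j]; rewrite !ffunE /=.
rewrite (reindex enum_rank) /=; last by exists enum_val => k _; rewrite ?enum_rankK ?enum_valK.
by apply: eq_bigr => k _; rewrite !ffunE.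
Qed.
End CPos.

Section TensorFamilies.
Variables (S : comNzRingType) (M N : lmodType S) (K : Type).
Variables (ra : M -> K -> M) (la : K -> N -> N).
Local Notation T := (tensor ra la).

Lemma tensor_fam (I : finType) (x : I -> T) : exists (m : nat) (y : I -> 'I_m -> M)
  (z : I -> 'I_m -> N), forall i, x i = \sum_k tpure ra la (y i k) (z i k).
Proof.
pose s i := trep (x i); pose m := (\max_i size (s i))%N.
exists m, (fun i k => (nth (0, 0) (s i) k).1), (fun i k => (nth (0, 0) (s i) k).2) => i.
have le : (size (s i) <= m)%N by apply: leq_bigmax.
rewrite [LHS]trep_sum (big_nth (0, 0)) -/(s i).
rewrite -(big_mkord xpredT (fun k => tpure ra la (nth (0, 0) (s i) k).1 (nth (0, 0) (s i) k).2)).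
rewrite (big_cat_nat (n := size (s i)) _ le) //= [X in _ = _ + X]big_nat_cond.
rewrite [X in _ = _ + X]big1 ?addr0 // => k /andP[/andP[le_k _] _].
by rewrite nth_default //= (addf0 (fun a b => tpureDl ra la a b _)).
Qed.

Lemma eq_tlift (V : zmodType) (b b' : M -> N -> V) (t : T) :
  (forall m n, b m n = b' m n) -> tlift b t = tlift b' t.
Proof. by move=> E; apply: eq_bigr. Qed.
End TensorFamilies.

Section InternalTensor.
Variables (R : realDomainType) (H : hopfStarAlg R) (B D : hstarAlg H).
Variables (F : hpreHilbert B) (X : hrep B D).
Local Notation C := (cplx R).
Local Notation "g ** h" := (sa_mul g h) (at level 40, left associativity).
Local Notation "g ^#" := (sa_star g) (at level 2, format "g ^#").
Local Notation pi := (@hr_pi _ _ _ _ X).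
Local Notation ip := (@ph_ip _ _ X).
Local Notation ipF := (@ph_ip _ _ F).

(* F tensored over B with X, on which B acts by the representation *)
Definition itens := tensor (@ph_act _ B F) pi.
HB.instance Definition _ := GRing.Lmodule.on itens.
Local Notation "y ⊗ x" := (tpure (@ph_act _ B F) pi y x) (at level 40).

Definition it_ip (s t : itens) : D :=
  tlift (fun y x => tlift (fun y' x' => ip x (pi (ipF y y') x')) t) s.
Definition it_ra (t : itens) d : itens := tlift (fun y x => y ⊗ ph_act x d) t.
Definition it_act g (t : itens) : itens :=
  tlift (fun y x => \sum_(p <- sw g) hp_act p.1 y ⊗ hp_act p.2 x) t.

Lemma ip_piZ1 c y y' x x' : ip x (pi (ipF (c *: y) y') x') = cconj c *: ip x (pi (ipF y y') x').
Proof. by rewrite ph_ipZ1 hr_Z1 ph_ipZ2. Qed.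
Lemma ip_pi_bal y b y' x x' :
  ip x (pi (ipF (ph_act y b) y') x') = ip (pi b x) (pi (ipF y y') x').
Proof.
have r := ph_rip F.
rewrite (rip_star r) (rip_act r) sa_starM -(rip_star r) hr_mul.
by rewrite hr_adj sa_starK.
Qed.

Lemma it_ip_tb2 y x :
  tbalanced (@ph_act _ B F) pi (fun y' x' => ip x (pi (ipF y y') x')) /\
  linear (tlift (ra := @ph_act _ B F) (la := pi) (fun y' x' => ip x (pi (ipF y y') x'))).
Proof.
apply: tlift_linear; first split.
- by move=> x' c a b; rewrite ph_ipD2 ph_ipZ2 hr_D1 hr_Z1 ph_ipD2 ph_ipZ2.
- by move=> y' c a b; rewrite hr_D2 hr_Z2 ph_ipD2 ph_ipZ2.
- by move=> y' b x'; rewrite (rip_act (ph_rip F)) hr_mul.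
- by move=> c y' b; rewrite ph_actZ1.
Qed.
Lemma it_ip_tb1 (t : itens) : tbalanced (@ph_act _ B F) pi
  (fun y x => tlift (fun y' x' => ip x (pi (ipF y y') x')) t).
Proof.
split=> [x a b|y a b|c y x|c y k x].
- by apply: tlift_split => y' x'; rewrite ph_ipD1 hr_D1 ph_ipD2.
- by apply: tlift_split => y' x'; rewrite ph_ipD1.
- by apply: eq_tlift => y' x'; rewrite ip_piZ1 ph_ipZ1.
- by apply: eq_tlift => y' x'; rewrite -ph_actZ1 ip_pi_bal.
Qed.
Lemma it_ipE y x y' x' : it_ip (y ⊗ x) (y' ⊗ x') = ip x (pi (ipF y y') x').
Proof. by rewrite /it_ip (tlift_pure (it_ip_tb1 _)) (tlift_pure (it_ip_tb2 _ _).1). Qed.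
Lemma it_ipD1 t : addf (it_ip^~ t).
Proof. exact: (tliftD (it_ip_tb1 t)). Qed.
Lemma it_ip_lin s : linear (it_ip s).
Proof.
move=> c t u; elim/tensor_ind: s => [|s s' IH IH'|y x].
- by rewrite !(addf0 (it_ipD1 _)) scaler0 addr0.
- by rewrite !it_ipD1 IH IH' scalerDr addrACA.
by rewrite /it_ip !(tlift_pure (it_ip_tb1 _)) (it_ip_tb2 y x).2.
Qed.
Lemma it_ipD2 s : addf (it_ip s). Proof. exact: linear_addf (it_ip_lin s). Qed.

Lemma it_ra_tb d : tbalanced (@ph_act _ B F) pi (fun y x => y ⊗ ph_act x d) /\
  linear (it_ra^~ d).
Proof.
apply: tlift_linear; first split.
- by move=> x c a b; rewrite tpureDl tpureZl.
- by move=> y c a b; rewrite ph_actD1 ph_actZ1 tpureDr tpureZr.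
- by move=> y b x; rewrite tpure_bal hr_act.
- by move=> c y' b; rewrite ph_actZ1.
Qed.
Lemma it_raE y x d : it_ra (y ⊗ x) d = y ⊗ ph_act x d.
Proof. exact: (tlift_pure (it_ra_tb d).1). Qed.
Lemma it_raD1 d : addf (it_ra^~ d). Proof. exact: linear_addf (it_ra_tb d).2. Qed.

Lemma hbal_pure (y : F) (x : X) :
  hbal2 (H := H) (fun g h => hp_act g y ⊗ hp_act h x).
Proof.
have mF := hp_hmodule F; have mX := hp_hmodule X.
split=> [h a b|g a b|c g h].
- by rewrite (hm_addl _ mF) tpureDl.
- by rewrite (hm_addl _ mX) tpureDr.
- by rewrite (hm_scall _ _ _ mF) (hm_scall _ _ _ mX) tpureZl tpureZr.
Qed.

Lemma it_act_tb g : tbalanced (@ph_act _ B F) pi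
    (fun y x => \sum_(p <- sw g) hp_act p.1 y ⊗ hp_act p.2 x) /\ linear (it_act g).
Proof.
have mF := hp_hmodule F; have mX := hp_hmodule X.
apply: tlift_linear; first split.
- move=> x c a b; rewrite scaler_sumr -big_split; apply: eq_bigr => p _.
  by rewrite (hm_addr _ mF) (hm_scalr _ _ _ mF) tpureDl tpureZl.
- move=> y c a b; rewrite scaler_sumr -big_split; apply: eq_bigr => p _.
  by rewrite (hm_addr _ mX) (hm_scalr _ _ _ mX) tpureDr tpureZr.
- move=> y b x.
  under eq_bigr do rewrite hp_act_mod (addf_sum (fun a b => tpureDl _ _ a b _)).
  under [RHS]eq_bigr do rewrite hr_mod (addf_sum (tpureDr _ _ _)).
  rewrite (sw_coassoc (b := fun g h k => ph_act (hp_act g y) (ha_act h b) ⊗ hp_act k x)).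
    by apply: eq_bigr => p _; apply: eq_bigr => q _; rewrite /= tpure_bal.
  have mB := ha_hmodule B.
  split=> *; rewrite /addf => *; rewrite ?(hm_addl _ mF, hm_addl _ mX, hm_addl _ mB)
    ?(hm_scall _ _ _ mF, hm_scall _ _ _ mX) ?(hm_scall _ _ _ mB)
    ?(ph_actD1, ph_actD2, ph_actZ1, ph_actZ2) ?(tpureDl, tpureDr, tpureZl) ?tpureZr //.
- by move=> c y' b; rewrite ph_actZ1.
Qed.
Lemma it_actE g y x : it_act g (y ⊗ x) = \sum_(p <- sw g) hp_act p.1 y ⊗ hp_act p.2 x.
Proof. exact: (tlift_pure (it_act_tb g).1). Qed.
Lemma it_actD2 g : addf (it_act g). Proof. exact: linear_addf (it_act_tb g).2. Qed.

Lemma it_rmodule : is_rmodule it_ra.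
Proof.
have r := ph_rmodule X; split.
- split=> [d|t c d e]; first exact: (it_ra_tb d).2.
  elim/tensor_ind: t => [|s t IH IH'|y x].
  + by rewrite !(addf0 (it_raD1 _)) scaler0 addr0.
  + by rewrite !it_raD1 IH IH' scalerDr addrACA.
  + by rewrite !it_raE ph_actD2 ph_actZ2 tpureDr tpureZr.
- move=> t d e; elim/tensor_ind: t => [|s t IH IH'|y x].
  + by rewrite !(addf0 (it_raD1 _)).
  + by rewrite !it_raD1 IH IH'.
  + by rewrite !it_raE (rm_assoc r).
- move=> e he t; elim/tensor_ind: t => [|s t IH IH'|y x].
  + by rewrite !(addf0 (it_raD1 _)).
  + by rewrite !it_raD1 IH IH'.
  + by rewrite !it_raE (rm_unit r).
Qed.

Lemma it_star s t : it_ip s t = (it_ip t s)^#.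
Proof.
elim/tensor_ind: s => [|s s' IH IH'|y x].
- by rewrite (addf0 (it_ipD1 _)) (addf0 (it_ipD2 _)) star0.
- by rewrite it_ipD1 it_ipD2 starD IH IH'.
elim/tensor_ind: t => [|t t' IH IH'|y' x'].
- by rewrite (addf0 (it_ipD1 _)) (addf0 (it_ipD2 _)) star0.
- by rewrite it_ipD1 it_ipD2 starD IH IH'.
rewrite !it_ipE hr_adj (rip_star (ph_rip X)); congr (ip _ (pi _ _))^#.
by rewrite -(rip_star (ph_rip F)).
Qed.

Lemma it_rip : is_rip it_ra it_ip.
Proof.
split; [exact: it_ip_lin| |move=> s t d|exact: it_star].
  by move=> t c s u; rewrite it_star it_ip_lin starD starZ -!it_star.
elim/tensor_ind: s => [|s s' IH IH'|y x].
- by rewrite !(addf0 (it_ipD1 _)) mul0l.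
- by rewrite !it_ipD1 mulDl IH IH'.
elim/tensor_ind: t => [|t t' IH IH'|y' x'].
- by rewrite (addf0 (it_raD1 _)) !(addf0 (it_ipD2 _)) mul0l.
- by rewrite it_raD1 !it_ipD2 mulDl IH IH'.
by rewrite it_raE !it_ipE hr_act (rip_act (ph_rip X)).
Qed.

Lemma it_cpos : ip_cpos it_ip.
Proof.
move=> n s w pw; have [m [y [x E]]] := tensor_fam s.
pose f (b : mxalg _ B) : mxalg 'I_n D := [ffun ij => \sum_(k < m) \sum_(l < m)
  ip (x ij.1 k) (pi (b ((ij.1, k), (ij.2, l))) (x ij.2 l))].
have -> : [ffun ij => it_ip (s ij.1) (s ij.2)] =
    f [ffun ab => ipF (y ab.1.1 ab.1.2) (y ab.2.1 ab.2.2)].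
  apply/ffunP => -[i j]; rewrite !ffunE /= !E (addf_sum (it_ipD1 _)).
  apply: eq_bigr => k _; rewrite (addf_sum (it_ipD2 _)).
  by apply: eq_bigr => l _; rewrite it_ipE !ffunE.
have [wl wp] := pw.
refine (@cpos_fin _ _ _ _ _ (fun a : 'I_n * 'I_m => y a.1 a.2) (@ph_cpos _ _ F)
  (fun b => w (f b)) _); split=> [c a b|a].
  rewrite -wl; congr w; apply/ffunP => -[i j]; rewrite !ffunE scaler_sumr -big_split /=.
  apply: eq_bigr => k _; rewrite scaler_sumr -big_split /=; apply: eq_bigr => l _.
  by rewrite !ffunE hr_D1 hr_Z1 ph_ipD2 ph_ipZ2.
pose u g i := \sum_(k < m) pi (a (g, (i, k))) (x i k).
have -> : f (sa_mul a^# a) = \sum_g [ffun ij => ip (u g ij.1) (u g ij.2)].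
  apply/ffunP => -[i j]; rewrite !ffunE sum_ffunE /=.
  under [RHS]eq_bigr do rewrite ffunE /= (addf_sum (ph_ipD1 _)).
  rewrite [RHS]exchange_big; apply: eq_bigr => k _ /=.
  under [RHS]eq_bigr do rewrite (addf_sum (ph_ipD2 _)).
  rewrite [RHS]exchange_big; apply: eq_bigr => l _ /=.
  rewrite !ffunE /= (addf_sum (hr_D1 _)) (addf_sum (ph_ipD2 _)).
  by apply: eq_bigr => g _; rewrite !ffunE /= hr_mul hr_adj sa_starK.
by apply: (pf_sum _ pw) => g; exact: (@ph_cpos _ _ X n (u g)).
Qed.

Lemma it_hmodule : is_hmodule it_act.
Proof.
have mF := hp_hmodule F; have mX := hp_hmodule X; split.
- split=> [t c g h|g]; last exact: (it_act_tb g).2.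
  elim/tensor_ind: t => [|s t IH IH'|y x].
  + by rewrite !(addf0 (it_actD2 _)) scaler0 addr0.
  + by rewrite !it_actD2 IH IH' scalerDr addrACA.
  rewrite !it_actE (sw_add _ _ (hbal_pure y x)) (sw_scale _ _ (hbal_pure y x)).
  rewrite scaler_sumr; congr (_ + _); apply: eq_bigr => p _.
  by rewrite (hm_scall _ _ _ mF) tpureZl.
- move=> g h t; elim/tensor_ind: t => [|s t IH IH'|y x].
  + by rewrite !(addf0 (it_actD2 _)).
  + by rewrite !it_actD2 IH IH'.
  rewrite !it_actE (sw_mul _ _ (hbal_pure y x)) (addf_sum (it_actD2 g)).
  rewrite exchange_big; apply: eq_bigr => q _; rewrite it_actE.
  by apply: eq_bigr => p _; rewrite (hm_assoc mF) (hm_assoc mX).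
- move=> t; elim/tensor_ind: t => [|s t IH IH'|y x].
  + by rewrite !(addf0 (it_actD2 _)).
  + by rewrite !it_actD2 IH IH'.
  by rewrite it_actE (sw_one (hbal_pure y x)) (hm_one mF) (hm_one mX).
Qed.

Lemma it_cov : rip_covariant it_act it_ip.
Proof.
have mF := hp_hmodule F; have mX := hp_hmodule X; have mB := ha_hmodule B.
have mD := ha_hmodule D; have mI := it_hmodule.
have r := it_rip; apply/rip_covP => //; [exact: rip_lin r|exact: rip_antilin r|].
move=> g s t.
elim/tensor_ind: t => [|t t' IH IH'|y' x'].
- rewrite (addf0 (it_actD2 _)) (addf0 (it_ipD2 _)) big1 // => p _.
  by rewrite (addf0 (it_ipD2 _)) (addf0 (hm_addr _ mD)).
- rewrite (it_actD2 g) (it_ipD2 s) IH IH' -big_split; apply: eq_bigr => p _.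
  by rewrite (it_ipD2 _) (hm_addr _ mD).
elim/tensor_ind: s => [|s s' IH IH'|y x].
- rewrite (addf0 (it_ipD1 _)) big1 // => p _.
  by rewrite (addf0 (it_actD2 _)) (addf0 (it_ipD1 _)) (addf0 (hm_addr _ mD)).
- rewrite it_ipD1 IH IH' -big_split; apply: eq_bigr => p _.
  by rewrite it_actD2 it_ipD1 (hm_addr _ mD).
pose b1 g1 g2 g3 := ip x (pi (ha_act g2 (ipF (hp_act g1^# y) y')) (hp_act g3 x')).
pose b2 g1 g2 g3 := ha_act g3 (ip (hp_act g2^# x) (pi (ipF (hp_act g1^# y) y') x')).
have h1 : hbal3 b1.
  rewrite /b1; split=> *; rewrite /addf => *; rewrite ?(starD, starZ)
    ?(hm_addl _ mF, hm_addl _ mX, hm_scall _ _ _ mF, hm_scall _ _ _ mX)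
    ?(ph_ipD1, ph_ipZ1) ?(hm_addl _ mB, hm_addr _ mB, hm_scall _ _ _ mB)
    ?(hm_scalr _ _ _ mB) ?(hr_D1, hr_D2) ?(hr_Z1, hr_Z2) ?(ph_ipD2, ph_ipZ2) ?cconjK //.
have h2 : hbal3 b2.
  rewrite /b2; split=> *; rewrite /addf => *; rewrite ?(starD, starZ)
    ?(hm_addl _ mF, hm_addl _ mX, hm_scall _ _ _ mF, hm_scall _ _ _ mX)
    ?(ph_ipD1, ph_ipZ1) ?(hr_D1, hr_Z1) ?(ph_ipD2, ph_ipZ2)
    ?(hm_addr _ mD, hm_scalr _ _ _ mD) ?(hm_addl _ mD, hm_scall _ _ _ mD) ?cconjK //.
transitivity (\sum_(p <- sw g) \sum_(q <- sw p.1) b1 q.1 q.2 p.2).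
  rewrite it_actE (addf_sum (it_ipD2 _)); apply: eq_bigr => p _.
  rewrite it_ipE hp_cov' (addf_sum (hr_D1 _)) (addf_sum (ph_ipD2 _)).
  by apply: eq_bigr.
rewrite (sw_coassoc _ h1).
transitivity (\sum_(p <- sw g) \sum_(q <- sw p.2) b2 p.1 q.1 q.2).
  apply: eq_bigr => p _; rewrite /b1 /b2 -(addf_sum (ph_ipD2 x)) -hr_mod.
  by rewrite hp_cov'.
rewrite -(sw_coassoc _ h2); apply: eq_bigr => p _.
rewrite it_actE; have hb : hbal2 (H := H) (fun g h => hp_act g y ⊗ hp_act h x).
  exact: hbal_pure.
rewrite (sw_star _ hb) (addf_sum (it_ipD1 _)) (addf_sum (hm_addr _ mD)).
by apply: eq_bigr => q _; rewrite it_ipE.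
Qed.

Definition itens_hipMod : hipMod D :=
  @HipMod _ _ D itens it_ra it_ip it_act it_rmodule it_rip it_cpos it_hmodule it_cov.

End InternalTensor.

Section LspanLemmas.
Variables (S : pzRingType) (V : lmodType S).
Lemma lspanD (P : set V) c x y : lspan P x -> lspan P y -> lspan P (c *: x + y).
Proof.
move=> [n [a [u [Pu ->]]]] [m [b [v [Pv ->]]]].
exists (n + m)%N, (fun k : 'I_(n + m) => match fintype.split k with inl i => c * a i | inr j => b j end).
exists (fun k : 'I_(n + m) => match fintype.split k with inl i => u i | inr j => v j end).
split=> [k|]; first by case: (fintype.split k).
rewrite big_split_ord scaler_sumr; congr (_ + _); apply: eq_bigr => k _.
  by rewrite -[lshift _ _]/(unsplit (inl k)) unsplitK scalerA.
by rewrite -[rshift _ _]/(unsplit (inr k)) unsplitK.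
Qed.
Lemma lspan0 (P : set V) : lspan P 0.
Proof. by exists 0%N, (fun=> 0), (fun=> 0); split=> [[]//|]; rewrite big_ord0. Qed.
Lemma lspan_in (P : set V) x : P x -> lspan P x.
Proof.
move=> Px; exists 1%N, (fun=> 1), (fun=> x).
by split=> //; rewrite big_ord1 scale1r.
Qed.
End LspanLemmas.

Section Covariance2.
Variables (R : realDomainType) (H : hopfStarAlg R).
Local Notation C := (cplx R).
Local Notation S g := (antipode H g).
Local Notation "g ** h" := (sa_mul g h) (at level 40, left associativity).
Local Notation "g ^#" := (sa_star g) (at level 2, format "g ^#").

Lemma rip_covS (A : hstarAlg H) (V : lmodType C) (act : H -> V -> V) (ip : V -> V -> A) :
  is_hmodule act -> (forall x, linear (ip x)) -> (forall y, antilin (ip^~ y)) ->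
  rip_covariant act ip -> forall g x y,
  \sum_(p <- sw g) ha_act p.1 (ip x (act (S p.2) y)) = ip (act (S g)^# x) y.
Proof.
move=> hm ipl ipa cov g x y.
have ipD1 z : addf (ip^~ z) by apply: antilin_addf.
have ipD2 z : addf (ip z) by apply: linear_addf.
have ipZ1 c u z : ip (c *: u) z = cconj c *: ip u z by exact: antilin_scal c u (ipa z).
have ipZ2 c u z : ip u (c *: z) = c *: ip u z by exact: linear_scal c z (ipl u).
under eq_bigr do rewrite cov.
under eq_bigr do under eq_bigr do rewrite -(hm_assoc hm).
rewrite (sw_coassoc (b := fun a b c => ip (act (S a)^# x) (act (b ** S c) y))).
  rewrite -[RHS](sw_counitr (f := fun g => ip (act (S g)^# x) y)); last first.
    by move=> a b; rewrite linearD starD (hm_addl _ hm) ipD1.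
  apply: eq_bigr => p _.
  rewrite -(addf_sum (f := fun h => ip (act (S p.1)^# x) (act h y))); last first.
    by move=> a b; rewrite (hm_addl _ hm) ipD2.
  rewrite ho_antipoder linearZ /= starZ !(hm_scall _ _ _ hm) (hm_one hm).
  by rewrite ipZ1 ipZ2 cconjK.
split=> *; rewrite /addf => *; rewrite ?linearD ?linearZ /= ?(mulDl, mulDr, mulZl, mulZr)
  ?(starD, starZ) ?(hm_addl _ hm, hm_scall _ _ _ hm) ?(ipD1, ipD2, ipZ1, ipZ2) ?cconjK
  ?(hm_scall _ _ _ hm, ipZ2) //.
Qed.

Lemma rep_cov_of_mod (A : hstarAlg H) (V : lmodType C) (act : H -> V -> V)
    (la : A -> V -> V) : is_hmodule act -> bilin la ->
  (forall g a x, act g (la a x) = \sum_(p <- sw g) la (ha_act p.1 a) (act p.2 x)) ->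
  forall g a x, la (ha_act g a) x = \sum_(p <- sw g) act p.1 (la a (act (S p.2) x)).
Proof.
move=> hm lb mod g a x.
have lD1 z : addf (la^~ z) by exact: linear_addf (lb.1 z).
have lD2 b : addf (la b) by exact: linear_addf (lb.2 b).
have lZ1 c b z : la (c *: b) z = c *: la b z by exact: linear_scal c b (lb.1 z).
have lZ2 c b z : la b (c *: z) = c *: la b z by exact: linear_scal c z (lb.2 b).
have hA := ha_hmodule A.
under eq_bigr do rewrite mod.
under eq_bigr do under eq_bigr do rewrite -(hm_assoc hm).
rewrite (sw_coassoc (b := fun h k l => la (ha_act h a) (act (k ** S l) x))).
  rewrite -[LHS](sw_counitr (f := fun g => la (ha_act g a) x)); last first.
    by move=> b c; rewrite (hm_addl _ hA) lD1.
  apply: eq_bigr => p _.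
  rewrite -(addf_sum (f := fun h => la (ha_act p.1 a) (act h x))); last first.
    by move=> b c; rewrite (hm_addl _ hm) lD2.
  by rewrite ho_antipoder !(hm_scall _ _ _ hm, hm_scall _ _ _ hA) (hm_one hm) lZ1 lZ2.
split=> *; rewrite /addf => *; rewrite ?linearD ?linearZ /= ?(mulDl, mulDr, mulZl, mulZr)
  ?(hm_addl _ hm, hm_scall _ _ _ hm) ?(hm_addl _ hA, hm_scall _ _ _ hA)
  ?(lD1, lD2, lZ1, lZ2) //.
Qed.

(* Left covariance follows from right covariance when B acts faithfully *)
Lemma lcov_of_rcov (B A : hstarAlg H) (V : lmodType C) (act : H -> V -> V)
    (la : B -> V -> V) (ra : V -> A -> V) (lip : V -> V -> B) (rip : V -> V -> A) :
  is_hmodule act -> bilin la -> bilin ra ->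
  (forall x, linear (rip x)) -> (forall y, antilin (rip^~ y)) ->
  (forall b, (forall x, la b x = 0) -> b = 0) ->
  (forall g a x, la (ha_act g a) x = \sum_(p <- sw g) act p.1 (la a (act (S p.2) x))) ->
  (forall g x a, act g (ra x a) = \sum_(p <- sw g) ra (act p.1 x) (ha_act p.2 a)) ->
  (forall x y z, la (lip x y) z = ra x (rip y z)) ->
  rip_covariant act rip -> lip_covariant act lip.
Proof.
move=> hm lb rb ipl ipa faithful lcov rmod compat cov g x y.
have lD1 z : addf (la^~ z) by exact: linear_addf (lb.1 z).
have rD1 a : addf (ra^~ a) by exact: linear_addf (rb.1 a).
have rD2 z : addf (ra z) by exact: linear_addf (rb.2 z).
have rZ1 c z a : ra (c *: z) a = c *: ra z a by exact: linear_scal c z (rb.1 a).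
have rZ2 c z a : ra z (c *: a) = c *: ra z a by exact: linear_scal c a (rb.2 z).
have ipD2 z : addf (rip z) by apply: linear_addf.
have ipZ2 c u z : rip u (c *: z) = c *: rip u z by exact: linear_scal c z (ipl u).
have hA := ha_hmodule A.
apply/eqP; rewrite -subr_eq0; apply/eqP/faithful => z.
rewrite (addfB (lD1 z)); apply/eqP; rewrite subr_eq0; apply/eqP.
rewrite lcov (addf_sum (lD1 z)).
under eq_bigr do rewrite compat rmod.
rewrite (sw_coassoc (b := fun h k l => ra (act h x) (ha_act k (rip y (act (S l) z))))).
  apply: eq_bigr => p _; rewrite compat -(addf_sum (rD2 _)).
  by rewrite (rip_covS hm ipl ipa cov).
split=> *; rewrite /addf => *; rewrite ?linearD ?linearZ /=
  ?(hm_addl _ hm, hm_scall _ _ _ hm) ?(ipD2, ipZ2)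
  ?(hm_addl _ hA, hm_addr _ hA, hm_scall _ _ _ hA, hm_scalr _ _ _ hA)
  ?(rD1, rD2, rZ1, rZ2) //.
Qed.
End Covariance2.

(* Induction of *-representations along an internal tensor product *)
Section Induction.
Variables (R : realDomainType) (H : hopfStarAlg R) (A B D : hstarAlg H).
Variables (F : hrep A B) (X : hrep B D).
Local Notation C := (cplx R).
Local Notation "g ** h" := (sa_mul g h) (at level 40, left associativity).
Local Notation "g ^#" := (sa_star g) (at level 2, format "g ^#").
Local Notation T := (itens F X).
Local Notation "y ⊗ x" := (tpure (@ph_act _ B F) (@hr_pi _ _ _ _ X) y x) (at level 40).

Definition it_la a (t : T) : T := tlift (fun y x => hr_pi a y ⊗ x) t.

Lemma it_la_tb a : tbalanced (@ph_act _ B F) (@hr_pi _ _ _ _ X) (fun y x => hr_pi a y ⊗ x) /\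
  linear (it_la a).
Proof.
apply: tlift_linear; first split.
- by move=> x c y z; rewrite hr_D2 hr_Z2 tpureDl tpureZl.
- by move=> y c x z; rewrite tpureDr tpureZr.
- by move=> y b x; rewrite hr_act tpure_bal.
- by move=> c y b; rewrite ph_actZ1.
Qed.
Lemma it_laE a y x : it_la a (y ⊗ x) = hr_pi a y ⊗ x.
Proof. exact: (tlift_pure (it_la_tb a).1). Qed.
Lemma it_laD2 a : addf (it_la a). Proof. exact: linear_addf (it_la_tb a).2. Qed.
Lemma it_la_lin t : linear (it_la^~ t).
Proof.
move=> c a b; elim/tensor_ind: t => [|s t IH IH'|y x].
- by rewrite !(addf0 (it_laD2 _)) scaler0 addr0.
- by rewrite !it_laD2 IH IH' scalerDr addrACA.
by rewrite !it_laE hr_D1 hr_Z1 tpureDl tpureZl.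
Qed.
Lemma it_la_mul a b t : it_la (a ** b) t = it_la a (it_la b t).
Proof.
elim/tensor_ind: t => [|s t IH IH'|y x]; first by rewrite !(addf0 (it_laD2 _)).
  by rewrite !it_laD2 IH IH'.
by rewrite !it_laE hr_mul.
Qed.
Lemma it_la_adj a s t : it_ip s (it_la a t) = it_ip (it_la a^# s) t.
Proof.
elim/tensor_ind: t => [|t t' IH IH'|y' x'].
- by rewrite (addf0 (it_laD2 _)) !(addf0 (it_ipD2 _)).
- by rewrite it_laD2 !it_ipD2 IH IH'.
elim/tensor_ind: s => [|s s' IH IH'|y x].
- by rewrite (addf0 (it_laD2 _)) !(addf0 (it_ipD1 _)).
- by rewrite it_laD2 !it_ipD1 IH IH'.
by rewrite !it_laE !it_ipE (@hr_adj _ _ _ _ F).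
Qed.
Lemma it_la_mod g a t :
  it_act g (it_la a t) = \sum_(p <- sw g) it_la (ha_act p.1 a) (it_act p.2 t).
Proof.
have mF := hp_hmodule F; have mX := hp_hmodule X; have mA := ha_hmodule A.
elim/tensor_ind: t => [|s t IH IH'|y x].
- rewrite (addf0 (it_laD2 _)) (addf0 (it_actD2 _)) big1 // => p _.
  by rewrite (addf0 (it_actD2 _)) (addf0 (it_laD2 _)).
- rewrite it_laD2 it_actD2 IH IH' -big_split; apply: eq_bigr => p _.
  by rewrite it_actD2 it_laD2.
rewrite it_laE it_actE.
under eq_bigr do rewrite hr_mod (addf_sum (fun a b => tpureDl _ _ a b _)).
under [RHS]eq_bigr do rewrite it_actE (addf_sum (it_laD2 _)).
rewrite (sw_coassoc (b := fun h k l => hr_pi (ha_act h a) (hp_act k y) ⊗ hp_act l x)).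
  by apply: eq_bigr => p _; apply: eq_bigr => q _; rewrite /= it_laE.
split=> *; rewrite /addf => *; rewrite ?(hm_addl _ mF, hm_addl _ mX, hm_scall _ _ _ mF)
    ?(hm_scall _ _ _ mX) ?(hm_addl _ mA, hm_scall _ _ _ mA)
    ?(hr_D1, hr_D2, hr_Z1) ?hr_Z2 ?(tpureDl, tpureDr, tpureZl) ?tpureZr //.
Qed.

Local Notation Q := (dquot (itens_hipMod F X)).
Local Notation "⟦ t ⟧" := (vproj (degen (itens_hipMod F X)) t).

Definition ind_la a : Q -> Q := @dq_map _ _ _ (itens_hipMod F X) (it_la a).
Lemma ind_laE a t : ind_la a ⟦ t ⟧ = ⟦ it_la a t ⟧.
Proof. by apply: dq_mapE => z y; apply: it_la_adj. Qed.

Lemma ind_la_lin q : linear (ind_la^~ q).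
Proof.
by move=> c a b; rewrite -[q]vreprK !ind_laE it_la_lin; apply: vproj_linear.
Qed.
Lemma ind_la_lin2 a : linear (ind_la a).
Proof.
move=> c p q; rewrite -[p]vreprK -[q]vreprK.
rewrite [LHS](congr1 (ind_la a) (vprojZD _ _ _)) !ind_laE (it_la_tb a).2.
exact: vproj_linear.
Qed.
Lemma ind_la_mul a b q : ind_la (a ** b) q = ind_la a (ind_la b q).
Proof. by rewrite -[q]vreprK !ind_laE it_la_mul. Qed.
Lemma ind_la_adj a p q : ph_ip p (ind_la a q) = ph_ip (ind_la a^# p) q.
Proof.
rewrite -[p]vreprK -[q]vreprK !ind_laE.
rewrite -[LHS]/(dq_ip _ _) -[RHS]/(dq_ip _ _) !dq_ipE; exact: it_la_adj.
Qed.
Lemma ind_la_mod g a (q : Q) :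
  hp_act g (ind_la a q) = \sum_(p <- sw g) ind_la (ha_act p.1 a) (hp_act p.2 q).
Proof.
rewrite -[q]vreprK ind_laE -[LHS]/(dq_act _ _) dq_actE -[im_act _ _]/(it_act _ _).
rewrite it_la_mod (addf_sum (@vproj_addf _ _ _ _)); apply: eq_bigr => p _.
by rewrite -[hp_act _ _]/(dq_act _ _) dq_actE ind_laE.
Qed.
Lemma ind_la_cov g a (q : Q) : ind_la (ha_act g a) q =
  \sum_(p <- sw g) hp_act p.1 (ind_la a (hp_act (antipode H p.2) q)).
Proof.
apply: rep_cov_of_mod; [exact: hp_hmodule| |exact: ind_la_mod].
by split; [exact: ind_la_lin|exact: ind_la_lin2].
Qed.

Definition hinduce : hrep A D :=
  @HRep _ _ A D Q ind_la ind_la_lin ind_la_mul ind_la_adj ind_la_cov.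
End Induction.

Section EquivalenceBimodules.
Variables (R : realDomainType) (H : hopfStarAlg R).
Local Notation C := (cplx R).
Local Notation "g ** h" := (sa_mul g h) (at level 40, left associativity).
Local Notation "g ^#" := (sa_star g) (at level 2, format "g ^#").

Section Underlying.
Variables (B A : hstarAlg H) (E : equivBimod B A).

Definition eb_ph : hpreHilbert A :=
  @HPreHilbert _ _ A (@PreHilbert _ A E (@eb_ra _ _ _ _ E) (@eb_rip _ _ _ _ E)
    (eb_rmodule E) (eb_is_rip E) (@eb_rnondeg _ _ _ _ E) (@eb_rcpos _ _ _ _ E))
    (@eb_act _ _ _ _ E) (eb_hmodule E) (@eb_rcov _ _ _ _ E).

Lemma eb_laD1 (x : E) : addf (fun b : B => eb_la b x).
Proof. exact: linear_addf ((lm_bilin (eb_lmodule E)).1 x). Qed.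
Lemma eb_laD2 (b : B) : addf (fun x : E => eb_la b x).
Proof. exact: linear_addf ((lm_bilin (eb_lmodule E)).2 b). Qed.
Lemma eb_laZ1 c (b : B) (x : E) : eb_la (c *: b) x = c *: eb_la b x.
Proof. exact: linear_scal ((lm_bilin (eb_lmodule E)).1 x). Qed.
Lemma eb_laZ2 c (b : B) (x : E) : eb_la b (c *: x) = c *: eb_la b x.
Proof. exact: linear_scal ((lm_bilin (eb_lmodule E)).2 b). Qed.
Lemma eb_lipD1 (y : E) : addf (fun x : E => eb_lip x y : B).
Proof. exact: linear_addf (lip_lin (eb_is_lip E) y). Qed.
Lemma eb_lipD2 (x : E) : addf (fun y : E => eb_lip x y : B).
Proof. exact: antilin_addf (lip_antilin (eb_is_lip E) x). Qed.
Lemma eb_lipZ1 c (x y : E) : eb_lip (c *: x) y = c *: eb_lip x y.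
Proof. exact: linear_scal (lip_lin (eb_is_lip E) y). Qed.
Lemma eb_lipZ2 c (x y : E) : eb_lip x (c *: y) = cconj c *: eb_lip x y.
Proof. exact: antilin_scal (lip_antilin (eb_is_lip E) x). Qed.

Lemma eb_mod g b (x : E) :
  eb_act g (eb_la b x) = \sum_(p <- sw g) eb_la (ha_act p.1 b) (eb_act p.2 x).
Proof.
have hm := eb_hmodule E; have hB := ha_hmodule B; have hA := ha_hmodule A.
pose P : set B := fun b => forall z : E,
  eb_act g (eb_la b z) = \sum_(p <- sw g) eb_la (ha_act p.1 b) (eb_act p.2 z).
suff: P b by [].
apply: lspan_ind (@eb_lfull _ _ _ _ E b).
- move=> z; rewrite (addf0 (eb_laD1 _)) (addf0 (hm_addr _ hm)) big1 // => p _.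
  by rewrite (addf0 (hm_addr _ hB)) (addf0 (eb_laD1 _)).
- move=> c b1 b2 P1 P2 z; rewrite eb_laD1 eb_laZ1 (hm_addr _ hm) (hm_scalr _ _ _ hm) P1 P2.
  rewrite scaler_sumr -big_split; apply: eq_bigr => p _.
  by rewrite (hm_addr _ hB) (hm_scalr _ _ _ hB) eb_laD1 eb_laZ1.
move=> _ [u [v ->]] z; rewrite eb_compat.
have := @hp_act_mod _ _ _ eb_ph g u (eb_rip v z) => /= ->.
have D2 (w : E) : addf (eb_ra w : A -> E).
  exact: linear_addf ((rm_bilin (eb_rmodule E)).2 w).
under eq_bigr do rewrite eb_rcov (addf_sum (D2 _)).
under eq_bigr do under eq_bigr do rewrite -eb_compat.
rewrite -(sw_coassoc (b := fun h k l => eb_la (eb_lip (eb_act h u)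
  (eb_act (antipode H k)^# v)) (eb_act l z))).
  apply: eq_bigr => p _.
  by rewrite (@eb_lcov _ _ _ _ E) (addf_sum (eb_laD1 _)).
split=> *; rewrite /addf => *; rewrite ?linearD ?linearZ /= ?(starD, starZ)
  ?(hm_addl _ hm, hm_scall _ _ _ hm) ?(eb_lipD1, eb_lipD2, eb_lipZ1) ?eb_lipZ2
  ?cconjK ?(eb_laD1, eb_laD2, eb_laZ1) ?eb_laZ2 //.
Qed.

Lemma eb_radj' b (x y : E) : eb_rip x (eb_la b y) = eb_rip (eb_la b^# x) y :> A.
Proof. by rewrite eb_radj sa_starK. Qed.
Lemma eb_lmul a b (x : E) : eb_la (a ** b) x = eb_la a (eb_la b x).
Proof. exact: lm_assoc (eb_lmodule E) _ _ _. Qed.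
Lemma eb_cov g b (x : E) : eb_la (ha_act g b) x =
  \sum_(p <- sw g) eb_act p.1 (eb_la b (eb_act (antipode H p.2) x)).
Proof.
apply: rep_cov_of_mod; [exact: eb_hmodule|exact: lm_bilin (eb_lmodule E)|exact: eb_mod].
Qed.

(* An equivalence bimodule is a covariant *-representation of B on a
   pre-Hilbert A-module *)
Definition eb_hrep : hrep B A := @HRep _ _ B A eb_ph (@eb_la _ _ _ _ E)
  (lm_bilin (eb_lmodule E)).1 eb_lmul eb_radj' eb_cov.

Lemma eb_faithful : sa_nondegenerate B -> forall b, (forall x : E, eb_la b x = 0) -> b = 0.
Proof.
move=> ndB b b0; apply: (ndB b).1 => b'.
apply: (lspan_ind (Q := fun b' => b ** b' = 0)) (@eb_lfull _ _ _ _ E b').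
- exact: mul0r'.
- by move=> c x y x0 y0; rewrite mulDr mulZr x0 y0 scaler0 addr0.
by move=> _ [x [y ->]]; rewrite -(lip_act (eb_is_lip E)) b0 (addf0 (eb_lipD1 _)).
Qed.
End Underlying.

Section Composition.
Variables (G B A : picObj H) (F : equivBimod G B) (E : equivBimod B A).
Local Notation FE := (hinduce (eb_hrep F) (eb_hrep E)).
Local Notation T := (itens (eb_hrep F) (eb_hrep E)).
Local Notation M := (itens_hipMod (eb_hrep F) (eb_hrep E)).
Local Notation "⟦ t ⟧" := (vproj (degen M) t).
Local Notation "y ⊗ x" := (tpure (@ph_act _ B (eb_hrep F)) (@hr_pi _ _ _ _ (eb_hrep E)) y x)
  (at level 40).

Definition it_lip (s t : T) : G :=
  tlift (fun y x => tlift (fun y' x' => eb_lip (eb_ra y (eb_lip x x')) y') t) s.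

Lemma eb_ra_lip_bal (y y' : F) (x x' : E) b :
  eb_lip (eb_ra y (eb_lip x x')) (eb_ra y' b) = eb_lip (eb_ra y (eb_lip x (eb_la b x'))) y' :> G.
Proof.
rewrite -[b in LHS]sa_starK -eb_ladj -(rm_assoc (eb_rmodule F)).
have l := eb_is_lip E; congr (eb_lip (eb_ra y _) y').
by rewrite [RHS](lip_star l) (lip_act l) sa_starM -(lip_star l).
Qed.

Lemma it_lip_tb2 (y : F) (x : E) :
  tbalanced (@ph_act _ B (eb_hrep F)) (@hr_pi _ _ _ _ (eb_hrep E))
    (fun y' x' => eb_lip (eb_ra y (eb_lip x x')) y' : G).
Proof.
have rm := rm_bilin (eb_rmodule F).
split=> [x' a b|y' a b|c y' x'|c y' b x'].
- exact: eb_lipD2.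
- by rewrite eb_lipD2 (linear_addf (rm.2 y)) eb_lipD1.
- rewrite [in RHS]eb_lipZ2 (linear_scal _ _ (rm.2 y)) [in RHS]eb_lipZ1.
  by rewrite eb_lipZ2.
- rewrite -[ph_act _ _]/(eb_ra y' b) -[hr_pi _ _]/(eb_la b x').
  by rewrite -(linear_scal _ _ (rm.1 b)) eb_ra_lip_bal.
Qed.
Lemma it_lip_tb1 (t : T) :
  tbalanced (@ph_act _ B (eb_hrep F)) (@hr_pi _ _ _ _ (eb_hrep E))
    (fun y x => tlift (fun y' x' => eb_lip (eb_ra y (eb_lip x x')) y') t : G).
Proof.
have rm := rm_bilin (eb_rmodule F).
split=> [x a b|y a b|c y x|c y b x].
- by apply: tlift_split => y' x'; rewrite (linear_addf (rm.1 _)) eb_lipD1.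
- by apply: tlift_split => y' x'; rewrite eb_lipD1 (linear_addf (rm.2 _)) eb_lipD1.
- apply: eq_tlift => y' x'.
  by rewrite eb_lipZ1 (linear_scal _ _ (rm.1 _)) (linear_scal _ _ (rm.2 _)).
- apply: eq_tlift => y' x'.
  rewrite -[ph_act _ _]/(eb_ra y b) -[hr_pi _ _]/(eb_la b x).
  rewrite !(linear_scal _ _ (rm.1 _)) (lip_act (eb_is_lip E)).
  by rewrite (rm_assoc (eb_rmodule F)).
Qed.
Lemma it_lipE y x y' x' : it_lip (y ⊗ x) (y' ⊗ x') = eb_lip (eb_ra y (eb_lip x x')) y'.
Proof. by rewrite /it_lip (tlift_pure (it_lip_tb1 _)) (tlift_pure (it_lip_tb2 _ _)). Qed.
Lemma it_lipD1 t : addf (it_lip^~ t).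
Proof. exact: tliftD (it_lip_tb1 t). Qed.
Lemma it_lipD2 s : addf (it_lip s).
Proof.
move=> t u; elim/tensor_ind: s => [|s s' IH IH'|y x].
- by rewrite !(addf0 (it_lipD1 _)) addr0.
- by rewrite !it_lipD1 IH IH' addrACA.
by rewrite /it_lip !(tlift_pure (it_lip_tb1 _)) (tliftD (it_lip_tb2 y x)).
Qed.
Lemma it_lip_star s t : it_lip s t = (it_lip t s)^#.
Proof.
elim/tensor_ind: s => [|s s' IH IH'|y x].
- by rewrite (addf0 (it_lipD1 _)) (addf0 (it_lipD2 _)) star0.
- by rewrite it_lipD1 it_lipD2 starD IH IH'.
elim/tensor_ind: t => [|t t' IH IH'|y' x'].
- by rewrite (addf0 (it_lipD1 _)) (addf0 (it_lipD2 _)) star0.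
- by rewrite it_lipD1 it_lipD2 starD IH IH'.
rewrite !it_lipE -(lip_star (eb_is_lip F)) eb_ladj.
by rewrite -(lip_star (eb_is_lip E)).
Qed.
Lemma it_lip_act a s t : it_lip (it_la a s : T) t = a ** it_lip s t.
Proof.
have l := lm_bilin (eb_lmodule F).
elim/tensor_ind: s => [|s s' IH IH'|y x].
- by rewrite (addf0 (it_laD2 _)) !(addf0 (it_lipD1 _)) mul0r'.
- by rewrite it_laD2 !it_lipD1 IH IH' mulDr.
elim/tensor_ind: t => [|t t' IH IH'|y' x'].
- by rewrite !(addf0 (it_lipD2 _)) mul0r'.
- by rewrite !it_lipD2 IH IH' mulDr.
rewrite it_laE !it_lipE -(lip_act (eb_is_lip F)).
by rewrite -eb_assoc.
Qed.
Lemma it_lip_adj s t a : it_lip (it_ra s a : T) t = it_lip s (it_ra t a^#).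
Proof.
elim/tensor_ind: s => [|s s' IH IH'|y x].
- by rewrite (addf0 (it_raD1 _)) !(addf0 (it_lipD1 _)).
- by rewrite it_raD1 !it_lipD1 IH IH'.
elim/tensor_ind: t => [|t t' IH IH'|y' x'].
- by rewrite (addf0 (it_raD1 _)) !(addf0 (it_lipD2 _)).
- by rewrite it_raD1 !it_lipD2 IH IH'.
rewrite !it_raE !it_lipE -[ph_act x a]/(eb_ra (x : E) a).
by rewrite -[ph_act x' _]/(eb_ra (x' : E) _) (@eb_ladj _ _ _ _ E).
Qed.
Lemma it_raD2 (s : T) : addf (it_ra s).
Proof. exact: linear_addf ((rm_bilin (im_rmodule M)).2 s). Qed.
Lemma it_raZ2 c (s : T) a : it_ra s (c *: a) = c *: it_ra s a.
Proof. exact: linear_scal ((rm_bilin (im_rmodule M)).2 s). Qed.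
Lemma it_laD1 (t : T) : addf ((@it_la _ _ _ _ _ (eb_hrep F) (eb_hrep E))^~ t).
Proof. exact: linear_addf (it_la_lin t). Qed.
Lemma it_compat s t u : it_la (it_lip s t) u = it_ra s (it_ip t u).
Proof.
elim/tensor_ind: s => [|s s' IH IH'|y x].
- by rewrite (addf0 (it_lipD1 _)) (addf0 (it_laD1 _)) (addf0 (it_raD1 _)).
- by rewrite it_lipD1 it_laD1 it_raD1 IH IH'.
elim/tensor_ind: t => [|t t' IH IH'|y' x'].
- by rewrite (addf0 (it_lipD2 _)) (addf0 (it_ipD1 _)) (addf0 (it_laD1 _)) (addf0 (it_raD2 _)).
- by rewrite it_lipD2 it_laD1 it_ipD1 it_raD2 IH IH'.
elim/tensor_ind: u => [|u u' IH IH'|y2 x2].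
- by rewrite (addf0 (it_ipD2 _)) (addf0 (it_laD2 _)) (addf0 (it_raD2 _)).
- by rewrite it_laD2 it_ipD2 it_raD2 IH IH'.
rewrite it_lipE it_laE it_ipE it_raE -[hr_pi _ _]/(eb_la (eb_lip _ _) (y2 : F)).
rewrite eb_compat -[ph_act x _]/(eb_ra (x : E) (eb_rip (x' : E) _)) -(@eb_compat _ _ _ _ E).
rewrite -[eb_ra (eb_ra _ _) _]/(ph_act (ph_act (y : eb_hrep F) _) _).
by rewrite !tpure_bal -[hr_pi _ x2]/(eb_la _ (x2 : E)).
Qed.

(* G acts faithfully on the quotient by the degeneracy space *)
Lemma it_faithful a : (forall u : T, degen M (it_la a u)) -> a = 0.
Proof.
move=> h; apply: (eb_faithful (E := F) (@po_nondeg _ _ G)) => y.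
apply: (@ph_nondeg _ _ (eb_hrep F)) => y'; rewrite (rip_star (ph_rip (eb_hrep F))) -[ph_ip _ _]/(eb_rip y' (eb_la a y)).
suff -> : eb_rip y' (eb_la a y) = 0 by rewrite star0.
apply: (eb_faithful (E := E) (@po_nondeg _ _ B)) => x.
apply: (@ph_nondeg _ _ (eb_hrep E)) => x'; rewrite (rip_star (ph_rip (eb_hrep E))).
have /degenP/(_ (y' ⊗ x')) := h (y ⊗ x).
by rewrite -[im_ip _ _]/(it_ip _ _) it_laE it_ipE => ->; rewrite star0.
Qed.

(* The degeneracy spaces of the two inner products agree *)
Lemma degen_lip s : degen M s <-> forall t, it_lip s t = 0.
Proof.
split=> [ds t|ds].
  rewrite it_lip_star (_ : it_lip t s = 0) ?star0 //; apply: it_faithful => u.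
  rewrite it_compat (_ : it_ip s u = 0); last exact: ds u.
  by rewrite (addf0 (it_raD2 _)); apply: smod0.
apply/degenP => t; rewrite -[im_ip _ _]/(it_ip _ _).
apply: (@po_nondeg _ _ A _).1 => a.
rewrite -(rip_act (im_rip M)) -[im_ra _ _]/(it_ra _ _) -[im_ip _ _]/(it_ip _ _).
suff: it_ra s a = 0 by move=> ->; rewrite (addf0 (it_ipD2 _)).
apply: (lspan_ind (Q := fun a => it_ra s a = 0)) (@eb_rfull _ _ _ _ E a).
- exact: addf0 (it_raD2 _).
- move=> c a1 a2 h1 h2; by rewrite it_raD2 it_raZ2 h1 h2 scaler0 addr0.
move=> _ [x [z ->]].
apply: (lspan_ind (Q := fun z : E => it_ra s (eb_rip x z) = 0)) (eb_lspan z).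
- by rewrite (addf0 (linear_addf (rip_lin (eb_is_rip E) x))) (addf0 (it_raD2 _)).
- move=> c z1 z2 h1 h2; rewrite (rip_lin (eb_is_rip E)).
  by rewrite it_raD2 it_raZ2 h1 h2 scaler0 addr0.
move=> _ [b [w ->]].
apply: (lspan_ind (Q := fun b : B => it_ra s (eb_rip x (eb_la b w)) = 0)) (@eb_rfull _ _ _ _ F b).
- by rewrite (addf0 (eb_laD1 _)) (addf0 (linear_addf (rip_lin (eb_is_rip E) x))) (addf0 (it_raD2 _)).
- move=> c z1 z2 h1 h2; rewrite eb_laD1 eb_laZ1 (rip_lin (eb_is_rip E)).
  by rewrite it_raD2 it_raZ2 h1 h2 scaler0 addr0.
move=> _ [y [y' ->]].
have := it_compat s (y ⊗ x) (y' ⊗ w); rewrite ds (addf0 (it_laD1 _)) it_ipE.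
by [].
Qed.

Definition ind_lip (p q : FE) : G := it_lip (vrepr p) (vrepr q).
Lemma ind_lipE s t : ind_lip ⟦ s ⟧ ⟦ t ⟧ = it_lip s t.
Proof.
have E1 u v w : degen M (u - v) -> it_lip u w = it_lip v w.
  move=> /degen_lip/(_ w); rewrite (addfB (it_lipD1 w)) => /eqP.
  by rewrite subr_eq0 => /eqP.
rewrite /ind_lip (E1 _ _ _ (vreprP _ s)) it_lip_star.
by rewrite (E1 _ _ _ (vreprP _ t)) -it_lip_star.
Qed.

End Composition.
End EquivalenceBimodules.

Section PicardComposition.
Variables (R : realDomainType) (H : hopfStarAlg R).
Variables (G B A : picObj H) (F : equivBimod G B) (E : equivBimod B A).
Local Notation C := (cplx R).
Local Notation "g ** h" := (sa_mul g h) (at level 40, left associativity).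
Local Notation "g ^#" := (sa_star g) (at level 2, format "g ^#").
Local Notation FE := (hinduce (eb_hrep F) (eb_hrep E)).
Local Notation T := (itens (eb_hrep F) (eb_hrep E)).
Local Notation M := (itens_hipMod (eb_hrep F) (eb_hrep E)).
Local Notation "⟦ t ⟧" := (vproj (degen M) t).
Local Notation "y ⊗ x" := (tpure (@ph_act _ B (eb_hrep F)) (@hr_pi _ _ _ _ (eb_hrep E)) y x)
  (at level 40).
Local Notation la := (@hr_pi _ _ _ _ FE).
Local Notation ra := (@ph_act _ A FE).
Local Notation rip := (@ph_ip _ A FE).
Local Notation act := (@hp_act _ _ _ FE).
Local Notation lip := (@ind_lip R H G B A F E).

Lemma ind_repr (q : FE) : q = ⟦ vrepr q ⟧. Proof. by rewrite vreprK. Qed.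

Lemma ind_lmodule : is_lmodule la.
Proof.
split; first by split; [exact: ind_la_lin|exact: ind_la_lin2].
  by move=> x a b; apply: ind_la_mul.
move=> e he q; rewrite (ind_repr q) -[LHS]/(ind_la _ _) ind_laE; congr vproj.
elim/tensor_ind: (vrepr q) => [|s t IH IH'|y x]; first by rewrite (addf0 (it_laD2 _)).
  by rewrite it_laD2 IH IH'.
rewrite it_laE; congr (_ ⊗ _); exact: lm_unit (eb_lmodule F) _ he y.
Qed.

Lemma ind_assoc b x a : ra (la b x) a = la b (ra x a).
Proof. by rewrite hr_act. Qed.

Lemma ind_lspan x : lspan [set z | exists b y, z = la b y] x.
Proof.
rewrite (ind_repr x); elim/tensor_ind: (vrepr x) => [|s t IH IH'|y z].
- by rewrite vproj0; [apply: lspan0|apply: smod0].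
- by rewrite -vprojD -[vproj _ s]scale1r; apply: lspanD.
apply: (lspan_ind (Q := fun y : F => lspan _ ⟦ y ⊗ z ⟧)) (eb_lspan y) => [|c u v hu hv|_ [b [u ->]]].
- rewrite (addf0 (fun a b => tpureDl _ _ a b _)).
  by rewrite vproj0; [apply: lspan0|apply: smod0].
- by rewrite tpureDl tpureZl vproj_linear; apply: lspanD.
apply: lspan_in; exists b, ⟦ u ⊗ z ⟧; rewrite -[RHS]/(ind_la _ _) ind_laE.
by rewrite it_laE.
Qed.

Lemma ind_rspan x : lspan [set z | exists y a, z = ra y a] x.
Proof.
rewrite (ind_repr x); elim/tensor_ind: (vrepr x) => [|s t IH IH'|y z].
- by rewrite vproj0; [apply: lspan0|apply: smod0].
- by rewrite -vprojD -[vproj _ s]scale1r; apply: lspanD.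
apply: (lspan_ind (Q := fun z : E => lspan _ ⟦ y ⊗ z ⟧)) (eb_rspan z) => [|c u v hu hv|_ [u [a ->]]].
- rewrite (addf0 (tpureDr _ _ _)).
  by rewrite vproj0; [apply: lspan0|apply: smod0].
- by rewrite tpureDr tpureZr vproj_linear; apply: lspanD.
apply: lspan_in; exists ⟦ y ⊗ u ⟧, a; rewrite -[RHS]/(dq_ra _ _) dq_raE.
by rewrite -[im_ra _ _]/(it_ra _ _) it_raE.
Qed.

Lemma it_lip_lin t : linear (fun s : T => it_lip s t : G).
Proof.
move=> c s u; rewrite it_lipD1; congr (_ + _).
elim/tensor_ind: s => [|s s' IH IH'|y x].
- by rewrite scaler0 (addf0 (it_lipD1 _)) scaler0.
- by rewrite scalerDr !it_lipD1 IH IH' scalerDr.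
elim/tensor_ind: t => [|t t' IH IH'|y' x'].
- by rewrite !(addf0 (it_lipD2 _)) scaler0.
- by rewrite !it_lipD2 IH IH' scalerDr.
rewrite -tpureZl !it_lipE (linear_scal _ _ ((rm_bilin (eb_rmodule F)).1 _)).
exact: eb_lipZ1.
Qed.

Lemma ind_is_lip : is_lip la lip.
Proof.
have lin : forall q, linear (lip^~ q).
  move=> q c p r; rewrite [p]ind_repr [q]ind_repr [r]ind_repr.
  by rewrite -vproj_linear !ind_lipE it_lip_lin.
have star p q : lip p q = (lip q p)^# by apply: it_lip_star.
split=> [|q c p r|p q a|]; [exact: lin| | |exact: star].
  by rewrite star lin starD starZ -!star.
rewrite [p]ind_repr [q]ind_repr -[la _ _]/(ind_la _ _) ind_laE !ind_lipE.
exact: it_lip_act.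
Qed.

Lemma lspan_sub (V W : lmodType C) (f : V -> W) (P : set V) (Q : set W) :
  linear f -> (forall x, P x -> lspan Q (f x)) -> forall x, lspan P x -> lspan Q (f x).
Proof.
move=> fl PQ; apply: lspan_ind => //.
  by rewrite (addf0 (linear_addf fl)); apply: lspan0.
by move=> c x y hx hy; rewrite fl; apply: lspanD.
Qed.

Lemma ind_lfull : ip_full lip.
Proof.
move=> c; have := @eb_lfull _ _ _ _ F c.
apply: (lspan_sub (f := id)) => // _ [y [y' ->]].
apply: (lspan_sub (f := fun y : F => eb_lip y y' : G)) (eb_rspan y).
  exact: lip_lin (eb_is_lip F) y'.
move=> _ [u [b ->]].
apply: (lspan_sub (f := fun b : B => eb_lip (eb_ra u b) y' : G)) (@eb_lfull _ _ _ _ E b).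
  by move=> k b1 b2; rewrite ((rm_bilin (eb_rmodule F)).2 u) (lip_lin (eb_is_lip F)).
move=> _ [x [x' ->]]; apply: lspan_in.
by exists ⟦ u ⊗ x ⟧, ⟦ y' ⊗ x' ⟧; rewrite ind_lipE it_lipE.
Qed.

Lemma ind_rfull : ip_full rip.
Proof.
move=> a; have := @eb_rfull _ _ _ _ E a.
apply: (lspan_sub (f := id)) => // _ [x [z ->]].
apply: (lspan_sub (f := fun z : E => eb_rip x z : A)) (eb_lspan z).
  exact: rip_lin (eb_is_rip E) x.
move=> _ [b [w ->]].
apply: (lspan_sub (f := fun b : B => eb_rip x (eb_la b w) : A)) (@eb_rfull _ _ _ _ F b).
  by move=> k b1 b2; rewrite ((lm_bilin (eb_lmodule E)).1 w) (rip_lin (eb_is_rip E)).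
move=> _ [y [y' ->]]; apply: lspan_in.
exists ⟦ y ⊗ x ⟧, ⟦ y' ⊗ w ⟧; rewrite -[RHS]/(dq_ip _ _) dq_ipE.
by rewrite -[im_ip _ _]/(it_ip _ _) it_ipE.
Qed.

Lemma ind_lnondeg : ip_nondegenerate lip.
Proof.
move=> p h; rewrite (ind_repr p); apply: vproj0; apply/degen_lip => t.
by rewrite -ind_lipE -ind_repr h.
Qed.

Lemma it_lip_cpos : ip_cpos (fun s t : T => it_lip s t : G).
Proof.
move=> n s w pw; have [m [y [x st]]] := tensor_fam s.
pose f (b : mxalg _ B) : mxalg 'I_n G := [ffun ij => \sum_(k < m) \sum_(l < m)
  eb_lip (eb_ra (y ij.1 k : F) (b ((ij.1, k), (ij.2, l)))) (y ij.2 l : F)].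
have -> : [ffun ij => it_lip (s ij.1) (s ij.2) : G] =
    f [ffun ab => eb_lip (x ab.1.1 ab.1.2 : E) (x ab.2.1 ab.2.2 : E) : B].
  apply/ffunP => -[i j]; rewrite !ffunE /= !st (addf_sum (it_lipD1 _)).
  apply: eq_bigr => k _; rewrite (addf_sum (it_lipD2 _)).
  by apply: eq_bigr => l _; rewrite it_lipE !ffunE.
have [wl wp] := pw.
have raD u : addf (fun b : B => eb_ra (u : F) b).
  exact: linear_addf ((rm_bilin (eb_rmodule F)).2 u).
have raD1 b : addf (fun u : F => eb_ra u (b : B)).
  exact: linear_addf ((rm_bilin (eb_rmodule F)).1 b).
refine (@cpos_fin _ _ _ _ _ (fun a : 'I_n * 'I_m => x a.1 a.2 : E) (@eb_lcpos _ _ _ _ E)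
  (fun b => w (f b)) _); split=> [c a b|a].
  rewrite -wl; congr w; apply/ffunP => -[i j]; rewrite !ffunE scaler_sumr -big_split /=.
  apply: eq_bigr => k _; rewrite scaler_sumr -big_split /=; apply: eq_bigr => l _.
  by rewrite !ffunE ((rm_bilin (eb_rmodule F)).2 _) (lip_lin (eb_is_lip F)).
pose u g i := \sum_(k < m) eb_ra (y i k : F) (a (g, (i, k)))^#.
have -> : f (sa_mul a^# a) = \sum_g [ffun ij => eb_lip (u g ij.1) (u g ij.2)].
  apply/ffunP => -[i j]; rewrite !ffunE sum_ffunE /=.
  under [RHS]eq_bigr do rewrite ffunE /= (addf_sum (eb_lipD1 _)).
  rewrite [RHS]exchange_big; apply: eq_bigr => k _ /=.
  under [RHS]eq_bigr do rewrite (addf_sum (eb_lipD2 _)).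
  rewrite [RHS]exchange_big; apply: eq_bigr => l _ /=.
  rewrite !ffunE /= (addf_sum (raD _)) (addf_sum (eb_lipD1 _)).
  apply: eq_bigr => g _; rewrite !ffunE /= (rm_assoc (eb_rmodule F)).
  by rewrite eb_ladj.
by apply: (pf_sum _ pw) => g; exact: (@eb_lcpos _ _ _ _ F n (u g)).
Qed.

Lemma ind_lcpos : ip_cpos lip.
Proof. by move=> n x; exact: (@it_lip_cpos n (fun i => vrepr (x i))). Qed.

Lemma ind_radj b x y : rip (la b x) y = rip x (la b^# y).
Proof. by rewrite hr_adj sa_starK. Qed.

Lemma ind_ladj a x y : lip (ra x a) y = lip x (ra y a^#).
Proof.
rewrite [x]ind_repr [y]ind_repr -![ra _ _]/(dq_ra _ _) !dq_raE !ind_lipE.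
exact: it_lip_adj.
Qed.

Lemma ind_compat x y z : la (lip x y) z = ra x (rip y z).
Proof.
rewrite [x]ind_repr [y]ind_repr [z]ind_repr ind_lipE.
rewrite -[LHS]/(ind_la _ _) ind_laE -[RHS]/(dq_ra _ (dq_ip _ _)) dq_ipE dq_raE.
by rewrite it_compat.
Qed.

Lemma ind_faithful b : (forall x, la b x = 0) -> b = 0.
Proof.
move=> h; apply: (@it_faithful _ _ _ _ _ F E) => u; apply: vproj_eq0.
by rewrite -ind_laE; apply: h.
Qed.

Lemma ind_lcov : lip_covariant act lip.
Proof.
apply: lcov_of_rcov ind_faithful _ _ ind_compat _.
- exact: hp_hmodule.
- exact: lm_bilin ind_lmodule.
- exact: rm_bilin (ph_rmodule FE).
- exact: rip_lin (ph_rip FE).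
- exact: rip_antilin (ph_rip FE).
- exact: hr_cov.
- exact: hp_act_mod.
- exact: hp_cov.
Qed.

(* The tensor product F (x)_B E divided by the degeneracy space of its A-valued
   inner product, which is also that of the G-valued one (degen_lip) *)
Definition itensor : equivBimod G A :=
  @EquivBimod _ _ G A FE la ra lip rip act ind_lmodule (ph_rmodule FE) ind_assoc
    ind_lspan ind_rspan ind_is_lip (ph_rip FE) ind_lfull ind_rfull
    ind_lnondeg (@ph_nondeg _ _ FE) ind_lcpos (@ph_cpos _ _ FE)
    ind_radj ind_ladj ind_compat (hp_hmodule FE) (@hp_cov _ _ _ FE) ind_lcov.

End PicardComposition.

Section PicardUnit.
Variables (R : realDomainType) (H : hopfStarAlg R) (A : picObj H).
Local Notation C := (cplx R).
Local Notation "g ** h" := (sa_mul g h) (at level 40, left associativity).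
Local Notation "g ^#" := (sa_star g) (at level 2, format "g ^#").

Definition unit_lip (a b : A) : A := a ** b^#.
Definition unit_rip (a b : A) : A := a^# ** b.

Lemma unit_lmodule : is_lmodule (@sa_mul _ A).
Proof.
by split=> [|x a b|e he x]; [exact: sa_bilin|rewrite sa_assoc|rewrite (he x).1].
Qed.
Lemma unit_rmodule : is_rmodule (@sa_mul _ A).
Proof.
by split=> [|x a b|e he x]; [exact: sa_bilin|rewrite sa_assoc|rewrite (he x).2].
Qed.
Lemma unit_span (x : A) : lspan [set z | exists a b, z = a ** b] x.
Proof. exact: po_idem. Qed.
Lemma unit_is_lip : is_lip (@sa_mul _ A) unit_lip.
Proof.
rewrite /unit_lip; split=> [y c a b|x c a b|x y a|x y].
- by rewrite mulDl mulZl.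
- by rewrite starD starZ mulDr mulZr.
- by rewrite sa_assoc.
- by rewrite sa_starM sa_starK.
Qed.
Lemma unit_is_rip : is_rip (@sa_mul _ A) unit_rip.
Proof.
rewrite /unit_rip; split=> [y c a b|x c a b|x y a|x y].
- by rewrite mulDr mulZr.
- by rewrite starD starZ mulDl mulZl.
- by rewrite sa_assoc.
- by rewrite sa_starM sa_starK.
Qed.
Lemma unit_lfull : ip_full unit_lip.
Proof.
move=> a; apply: (lspan_sub (f := id)) (unit_span a) => // _ [x [y ->]].
by apply: lspan_in; exists x, y^#; rewrite /unit_lip sa_starK.
Qed.
Lemma unit_rfull : ip_full unit_rip.
Proof.
move=> a; apply: (lspan_sub (f := id)) (unit_span a) => // _ [x [y ->]].
by apply: lspan_in; exists x^#, y; rewrite /unit_rip sa_starK.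
Qed.
Lemma unit_lnondeg : ip_nondegenerate unit_lip.
Proof.
move=> x h; apply: (@po_nondeg _ _ A x).1 => b.
by rewrite -[b]sa_starK; apply: h.
Qed.
Lemma unit_rnondeg : ip_nondegenerate unit_rip.
Proof.
move=> x h; rewrite -[x]sa_starK (_ : x^# = 0) ?star0 //.
by apply: (@po_nondeg _ _ A _).1 => b; apply: h.
Qed.
Lemma gram_pos n (v : 'I_n -> A) :
  @positive_elt _ (mxalg 'I_n A) [ffun ij => (v ij.1)^# ** v ij.2].
Proof.
move=> w [_ wp].
pose N : mxalg 'I_n A := [ffun ij : 'I_n * 'I_n => if val ij.1 == 0%N then v ij.2 else 0].
suff -> : [ffun ij => (v ij.1)^# ** v ij.2] = sa_mul (sa_star N) N by apply: wp.
apply/ffunP => -[i j]; rewrite !ffunE /=.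
case: n v w wp @N i j => [|n] v w wp N i j; first by case: i.
rewrite (bigD1 ord0) //= !ffunE /= big1 ?addr0 // => k k0.
by rewrite !ffunE /= (negPf (_ : val k != 0%N)) ?star0 ?mul0l.
Qed.
Lemma unit_rcpos : ip_cpos unit_rip.
Proof. by move=> n x; apply: gram_pos. Qed.
Lemma unit_lcpos : ip_cpos unit_lip.
Proof.
move=> n x; rewrite (_ : [ffun ij => _] = [ffun ij => (x ij.1)^#^# ** (x ij.2)^#]).
  exact: (gram_pos (fun i => (x i)^#)).
by apply/ffunP => ij; rewrite !ffunE sa_starK.
Qed.
Lemma unit_radj (b x y : A) : unit_rip (b ** x) y = unit_rip x (b^# ** y).
Proof. by rewrite /unit_rip sa_starM sa_assoc. Qed.
Lemma unit_ladj (a x y : A) : unit_lip (x ** a) y = unit_lip x (y ** a^#).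
Proof. by rewrite /unit_lip sa_starM sa_starK sa_assoc. Qed.
Lemma unit_compat (x y z : A) : unit_lip x y ** z = x ** unit_rip y z.
Proof. by rewrite /unit_lip /unit_rip sa_assoc. Qed.
Lemma unit_rcov : rip_covariant (@ha_act _ _ A) unit_rip.
Proof.
move=> g x y; rewrite /unit_rip ha_mul; apply: eq_bigr => p _.
by rewrite ha_star ho_antipode_star.
Qed.
Lemma unit_lcov : lip_covariant (@ha_act _ _ A) unit_lip.
Proof.
move=> g x y; rewrite /unit_lip ha_mul; apply: eq_bigr => p _.
by rewrite ha_star ho_antipode_star.
Qed.

Definition unitBimod : equivBimod A A :=
  @EquivBimod _ _ A A A (@sa_mul _ A) (@sa_mul _ A) unit_lip unit_rip (@ha_act _ _ A)
    unit_lmodule unit_rmodule (fun b x a => esym (sa_assoc b x a)) unit_span unit_span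
    unit_is_lip unit_is_rip unit_lfull unit_rfull unit_lnondeg unit_rnondeg
    unit_lcpos unit_rcpos unit_radj unit_ladj unit_compat (ha_hmodule A)
    unit_rcov unit_lcov.
End PicardUnit.

Section ClosedIdeals.
Variables (R : realDomainType) (H : hopfStarAlg R) (D : hstarAlg H).

Definition closed_ideals (A : hstarAlg H) : set (set A) :=
  [set J | exists X : hrep A D, J = [set a | forall x, hr_pi (h := X) a x = 0]].

Definition ideal_closure (A : hstarAlg H) (J : set A) : set A :=
  \bigcap_(K in [set K | closed_ideals K /\ J `<=` K]) K.

Definition ideal_meet (A : hstarAlg H) (I J : set A) : set A := I `&` J.
Definition ideal_join (A : hstarAlg H) (I J : set A) : set A := ideal_closure (I `|` J).

Definition lattice_iso (A B : hstarAlg H) (f : set A -> set B) :=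
  [/\ set_bij (@closed_ideals A) (@closed_ideals B) f,
   forall I J, closed_ideals I -> closed_ideals J ->
     f (ideal_meet I J) = ideal_meet (f I) (f J) &
   forall I J, closed_ideals I -> closed_ideals J ->
     f (ideal_join I J) = ideal_join (f I) (f J)].

End ClosedIdeals.

Definition Phi (R : realDomainType) (H : hopfStarAlg R) (B A : hstarAlg H)
    (E : equivBimod B A) (J : set A) : set B :=
  [set b | forall x y : E, J (eb_rip x (eb_la b y))].

(* Main.v *)
Require Import Defs.
From HB Require Import structures.
From mathcomp Require Import all_boot all_order all_algebra.
From mathcomp Require Import boolp classical_sets functions.

Set Implicit Arguments.
Unset Strict Implicit.
Unset Printing Implicit Defensive.

Import GRing.Theory.
Local Open Scope classical_set_scope.
Local Open Scope ring_scope.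
Local Notation addf := Defs.addf.

(* If J is the kernel of a representation X of A, then Phi E J is the kernel of the
   representation of B induced from X along E, hence closed. The conjugate bimodule of
   E induces in the opposite direction, and a lies in Phi (conj E) (Phi E J) iff all
   <u, x> a <y, v> lie in J, which by fullness means c a d in J for all c, d in A. For
   admissible D, a^* a in J forces a in J, so this is equivalent to a in J: the two maps
   are mutually inverse and monotone, hence lattice isomorphisms. *)

(** * The antipode reverses products and fixes the unit *)

Section Antipode.
Variables (R : realDomainType) (H : hopfStarAlg R).
Local Notation S g := (antipode H g).
Local Notation "g ** h" := (sa_mul g h) (at level 40, left associativity).

Let mul1 (g : H) : ho_one H ** g = g. Proof. exact: (ho_unit g).1. Qed.
Let mulr1 (g : H) : g ** ho_one H = g. Proof. exact: (ho_unit g).2. Qed.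
Let mulD1 (h : H) : addf (fun g : H => g ** h). Proof. by move=> x y; apply: mulDl. Qed.
Let mulD2 (g : H) : addf (fun h : H => g ** h). Proof. by move=> x y; apply: mulDr. Qed.

Let hbal_antipodel : hbal2 (H := H) (fun a b : H => S a ** b).
Proof.
split=> [h x y|g x y|c g h]; first by rewrite linearD mulDl.
  by rewrite mulDr.
by rewrite linearZ /= mulZl mulZr.
Qed.

Lemma antipode1 : S (ho_one H) = ho_one H.
Proof.
have := sw_one hbal_antipodel.
by rewrite mulr1 [LHS]ho_antipodel ho_counit1 scale1r => <-.
Qed.

Let antipodeM_left g h : \sum_(p <- sw g) \sum_(q <- sw h)
    S (p.1 ** q.1) ** (p.2 ** q.2) = (counit H g * counit H h) *: ho_one H.
Proof. by rewrite -(sw_mul g h hbal_antipodel) [LHS]ho_antipodel ho_counitM. Qed.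

(** The inner pair [q.1 ** S q.2] is contracted first; this leaves the antipode axiom for [g], up to
    the scalar [counit H h]. *)
Let antipodeM_right g h : \sum_(p <- sw g) \sum_(q <- sw h)
    p.1 ** q.1 ** (S q.2 ** S p.2) = (counit H g * counit H h) *: ho_one H.
Proof.
transitivity (\sum_(p <- sw g) p.1 ** (counit H h *: S p.2)).
  apply: eq_bigr => p _; rewrite -[S p.2 in RHS]mul1 -mulZl -ho_antipoder.
  rewrite (addf_sum (mulD1 _)) (addf_sum (mulD2 _)).
  by apply: eq_bigr => q _; rewrite !sa_assoc.
under eq_bigr do rewrite mulZr.
by rewrite -scaler_sumr ho_antipoder scalerA mulrC.
Qed.

(* Both sides are convolution inverses of the product: evaluate
   S(g_(1) h_(1)) g_(2) h_(2) S(h_(3)) S(g_(3)) in two ways. *)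
Lemma antipodeM g h : S (g ** h) = S h ** S g.
Proof.
pose b g1 g2 g3 h1 h2 h3 : H := S (g1 ** h1) ** ((g2 ** h2) ** (S h3 ** S g3)).
have bE g1 g2 g3 h1 h2 h3 : b g1 g2 g3 h1 h2 h3 =
    (S (g1 ** h1) ** (g2 ** h2)) ** (S h3 ** S g3) by rewrite /b sa_assoc.
have bh g1 g2 g3 : hbal3 (b g1 g2 g3).
  rewrite /b; split=> *; rewrite /addf => *;
    do ?[rewrite ?linearD ?linearZ /= ?(mulDl, mulDr, mulZl, mulZr)] => //.
have bg : hbal3 (fun g1 g2 g3 => \sum_(r <- sw h) \sum_(s <- sw r.2) b g1 g2 g3 r.1 s.1 s.2).
  rewrite /b; split=> *; rewrite /addf => *; rewrite -?big_split /=; apply: eq_bigr => r _;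
    rewrite -?big_split /=; apply: eq_bigr => s _;
    do ?[rewrite ?linearD ?linearZ /= ?(mulDl, mulDr, mulZl, mulZr)] => //.
have counit2 (f : H -> H -> H) : bilin f ->
    \sum_(p <- sw g) \sum_(r <- sw h) (counit H p.2 * counit H r.2) *: f p.1 r.1 = f g h.
  move=> [f1 f2]; rewrite -[RHS](sw_counitr _ (linear_addf (f1 h))).
  apply: eq_bigr => p _; rewrite (linear_scal _ _ (f1 h)).
  rewrite -[in RHS](sw_counitr _ (linear_addf (f2 p.1))) scaler_sumr.
  by apply: eq_bigr => r _; rewrite (linear_scal _ _ (f2 _)) scalerA.
have counit2' (f : H -> H -> H) : bilin f ->
    \sum_(p <- sw g) \sum_(r <- sw h) (counit H p.1 * counit H r.1) *: f p.2 r.2 = f g h.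
  move=> [f1 f2]; rewrite -[RHS](sw_counitl _ (linear_addf (f1 h))).
  apply: eq_bigr => p _; rewrite (linear_scal _ _ (f1 h)).
  rewrite -[in RHS](sw_counitl _ (linear_addf (f2 p.2))) scaler_sumr.
  by apply: eq_bigr => r _; rewrite (linear_scal _ _ (f2 _)) scalerA.
have E := sw_coassoc g bg.
(* Grouped this way, [g_(2) h_(2) S(h_(3)) S(g_(3))] contracts to counits and only [S(g h)]
   remains. *)
transitivity (\sum_(p <- sw g) \sum_(q <- sw p.2)
    \sum_(r <- sw h) \sum_(s <- sw r.2) b p.1 q.1 q.2 r.1 s.1 s.2).
  rewrite -[LHS](counit2 (fun g h => S (g ** h))); last first.
    by split=> [z c x y|z c x y]; rewrite ?mulDl ?mulDr ?mulZl ?mulZr linearP.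
  apply: eq_bigr => p _; rewrite exchange_big /=.
  apply: eq_bigr => r _; rewrite -[S _ in LHS]mulr1 -mulZr -antipodeM_right.
  rewrite (addf_sum (mulD2 _)).
  by apply: eq_bigr => q _; rewrite (addf_sum (mulD2 _)).
rewrite -E.
(* After coassociativity in both [g] and [h], the factor [S(g_(1) h_(1)) g_(2) h_(2)] contracts
   instead and leaves [S(h) S(g)]. *)
transitivity (\sum_(p <- sw g) \sum_(q <- sw p.1)
    \sum_(r <- sw h) \sum_(s <- sw r.1) b q.1 q.2 p.2 s.1 s.2 r.2).
  by apply: eq_bigr => p _; apply: eq_bigr => q _; rewrite (sw_coassoc h (bh _ _ _)).
rewrite -[RHS](counit2' (fun g h => S h ** S g)); last first.
  by split=> [z c x y|z c x y]; rewrite linearP ?mulDl ?mulDr ?mulZl ?mulZr.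
apply: eq_bigr => p _; rewrite exchange_big /=.
apply: eq_bigr => r _; rewrite -[S _ ** _ in RHS]mul1 -mulZl -antipodeM_left.
rewrite (addf_sum (mulD1 _)).
apply: eq_bigr => q _; rewrite (addf_sum (mulD1 _)).
by apply: eq_bigr => s _; rewrite bE.
Qed.
End Antipode.

(* An alias of V that carries the conjugate scalar action. *)
Definition conjmod (R : realDomainType) (V : lmodType (cplx R)) : Type := V.

(** * The complex conjugate of a module *)

Section ConjugateModule.
Variables (R : realDomainType) (V : lmodType (cplx R)).
HB.instance Definition _ := GRing.Zmodule.on (conjmod V).

Definition conj_scale (c : cplx R) (x : conjmod V) : conjmod V := cconj c *: (x : V).

Lemma conj_scaleA a b x : conj_scale a (conj_scale b x) = conj_scale (a * b) x.
Proof. by rewrite /conj_scale scalerA cconjM. Qed.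
Lemma conj_scale1 : left_id 1 conj_scale.
Proof. by move=> x; rewrite /conj_scale cconj1 scale1r. Qed.
Lemma conj_scaleDr : right_distributive conj_scale +%R.
Proof. by move=> a x y; apply: scalerDr. Qed.
Lemma conj_scaleDl x : {morph conj_scale^~ x : a b / a + b}.
Proof. by move=> a b; rewrite /conj_scale cconjD scalerDl. Qed.
HB.instance Definition _ := GRing.Zmodule_isLmodule.Build (cplx R) (conjmod V)
  conj_scaleA conj_scale1 conj_scaleDr conj_scaleDl.

Lemma conj_lspan (P : set V) x : lspan P x -> lspan (V := conjmod V) P x.
Proof.
move=> [n [c [y [Py ->]]]]; exists n, (fun i => cconj (c i)), y; split=> //.
by apply: eq_bigr => i _; rewrite -[RHS]/(conj_scale _ _) /conj_scale cconjK.
Qed.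
End ConjugateModule.

(** * The conjugate of an equivalence bimodule *)

Section ConjugateBimodule.
Variables (R : realDomainType) (H : hopfStarAlg R).
Local Notation "g ** h" := (sa_mul g h) (at level 40, left associativity).
Local Notation "g ^#" := (sa_star g) (at level 2, format "g ^#").
Variables (B A : hstarAlg H) (E : equivBimod B A).
Local Notation cE := (conjmod E).
Local Notation S g := (antipode H g).

Definition cj_la (a : A) (x : cE) : cE := eb_ra (x : E) a^#.
Definition cj_ra (x : cE) (b : B) : cE := eb_la b^# (x : E).
Definition cj_lip (x y : cE) : A := eb_rip (x : E) (y : E).
Definition cj_rip (x y : cE) : B := eb_lip (x : E) (y : E).
(** The twist [g] to [(S g)^#] is antilinear, as the conjugate scalars require, and multiplicative,
    since [S] and the star both reverse products. It is also an involution, which exchanges the left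
    and right covariance laws. *)
Definition cj_act (g : H) (x : cE) : cE := eb_act (S g)^# (x : E).

Let lm := eb_lmodule E.
Let rm := eb_rmodule E.
Let l := eb_is_lip E.
Let r := eb_is_rip E.
Let hm := eb_hmodule E.

Lemma unit_star (X : starAlg R) (e : X) : sa_unit e -> e^# = e.
Proof.
move=> he; have [h _] := he e^#; have := congr1 (@sa_star _ X) h.
by rewrite sa_starM sa_starK h.
Qed.

Lemma cj_lmodule : is_lmodule cj_la.
Proof.
split=> [|x a b|e he x].
- split=> [x c a b|a c x y].
  + rewrite /cj_la starD starZ; exact: (rm_bilin rm).2.
  + exact: (rm_bilin rm).1.
- by rewrite /cj_la sa_starM (rm_assoc rm).
- by rewrite /cj_la unit_star // (rm_unit rm).
Qed.
Lemma cj_rmodule : is_rmodule cj_ra.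
Proof.
split=> [|x a b|e he x].
- split=> [a c x y|x c a b].
  + exact: (lm_bilin lm).2.
  + rewrite /cj_ra starD starZ; exact: (lm_bilin lm).1.
- by rewrite /cj_ra sa_starM (lm_assoc lm).
- by rewrite /cj_ra unit_star // (lm_unit lm).
Qed.
Lemma cj_assoc a x b : cj_ra (cj_la a x) b = cj_la a (cj_ra x b).
Proof. by rewrite /cj_ra /cj_la eb_assoc. Qed.
Lemma cj_lspan (x : cE) : lspan [set z | exists a y, z = cj_la a y] x.
Proof.
apply: conj_lspan; apply: (lspan_sub (f := id)) (eb_rspan x) => // _ [y [a ->]].
by apply: lspan_in; exists a^#, y; rewrite /cj_la sa_starK.
Qed.
Lemma cj_rspan (x : cE) : lspan [set z | exists y b, z = cj_ra y b] x.
Proof.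
apply: conj_lspan; apply: (lspan_sub (f := id)) (eb_lspan x) => // _ [b [y ->]].
by apply: lspan_in; exists y, b^#; rewrite /cj_ra sa_starK.
Qed.
Lemma cj_is_lip : is_lip cj_la cj_lip.
Proof.
split=> [y c x z|x c y z|x y a|x y]; last exact: rip_star r _ _.
- by rewrite /cj_lip (rip_antilin r) cconjK.
- exact: rip_lin r _ _ _ _.
- by rewrite /cj_lip /cj_la (rip_star r) (rip_act r) sa_starM sa_starK -(rip_star r).
Qed.
Lemma cj_is_rip : is_rip cj_ra cj_rip.
Proof.
split=> [x c y z|y c x z|x y b|x y]; last exact: lip_star l _ _.
- by rewrite /cj_rip (lip_antilin l) cconjK.
- exact: lip_lin l _ _ _ _.
- by rewrite /cj_rip /cj_ra (lip_star l) (lip_act l) sa_starM sa_starK -(lip_star l).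
Qed.
Lemma cj_radj a x y : cj_rip (cj_la a x) y = cj_rip x (cj_la a^# y).
Proof. exact: eb_ladj. Qed.
Lemma cj_ladj b x y : cj_lip (cj_ra x b) y = cj_lip x (cj_ra y b^#).
Proof. exact: eb_radj. Qed.
Lemma cj_compat x y z : cj_la (cj_lip x y) z = cj_ra x (cj_rip y z).
Proof. by rewrite /cj_la /cj_ra -(rip_star r) -(lip_star l) eb_compat. Qed.
Lemma cj_hmodule : is_hmodule cj_act.
Proof.
split=> [|g h x|x].
- split=> [x c g h|g c x y]; last exact: (hm_bilin hm).2.
  rewrite /cj_act linearP starD starZ; exact: (hm_bilin hm).1.
- by rewrite /cj_act antipodeM sa_starM (hm_assoc hm).
- by rewrite /cj_act antipode1 star_one (hm_one hm).
Qed.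
Lemma cj_rcov : rip_covariant cj_act cj_rip.
Proof.
move=> g x y; rewrite /cj_rip eb_lcov; apply: eq_bigr => p _.
by rewrite /cj_act ho_antipode_star.
Qed.
Lemma cj_lcov : lip_covariant cj_act cj_lip.
Proof.
move=> g x y; rewrite /cj_lip eb_rcov; apply: eq_bigr => p _.
by rewrite /cj_act ho_antipode_star.
Qed.

Definition conjBimod : equivBimod A B :=
  @EquivBimod _ _ A B cE cj_la cj_ra cj_lip cj_rip cj_act cj_lmodule cj_rmodule cj_assoc
    cj_lspan cj_rspan cj_is_lip cj_is_rip (@eb_rfull _ _ _ _ E) (@eb_lfull _ _ _ _ E)
    (@eb_rnondeg _ _ _ _ E) (@eb_lnondeg _ _ _ _ E) (@eb_rcpos _ _ _ _ E)
    (@eb_lcpos _ _ _ _ E) cj_radj cj_ladj cj_compat cj_hmodule cj_rcov cj_lcov.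

End ConjugateBimodule.

Section ClosedIdeals.
Variables (R : realDomainType) (H : hopfStarAlg R) (D : hstarAlg H).
Local Notation C := (cplx R).
Local Notation "g ** h" := (sa_mul g h) (at level 40, left associativity).
Local Notation "g ^#" := (sa_star g) (at level 2, format "g ^#").

(** * Closed ideals of a single algebra *)

Section OneAlgebra.
Variables (A : hstarAlg H) (J : set A).
Hypothesis clJ : closed_ideals D J.

Lemma closed_ideal0 : J 0.
Proof. by case: clJ => X -> x; rewrite (addf0 (hr_D1 x)). Qed.
Lemma closed_idealD c a b : J a -> J b -> J (c *: a + b).
Proof. by case: clJ => X -> ha hb x; rewrite hr_D1 hr_Z1 ha hb scaler0 addr0. Qed.
Lemma closed_ideal_mul a b : J a -> J (a ** b) /\ J (b ** a).
Proof.
case: clJ => X -> ha; split=> x; first by rewrite hr_mul ha.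
by rewrite hr_mul ha (addf0 (hr_D2 _)).
Qed.
Lemma closed_ideal_lspan (V : lmodType C) (f : V -> A) (P : set V) : linear f ->
  (forall x, P x -> J (f x)) -> forall x, lspan P x -> J (f x).
Proof.
move=> fl PJ; apply: lspan_ind => //.
  by rewrite (addf0 (linear_addf fl)); apply: closed_ideal0.
by move=> c x y Jx Jy; rewrite fl; apply: closed_idealD.
Qed.

Hypothesis hD : admissible D.

(** Admissibility enters here: [<pi(a) x, pi(a) x> = <x, pi(a^# a) x> = 0] forces [pi(a) x = 0]. *)
Lemma closed_ideal_starmul a : J (a^# ** a) -> J a.
Proof.
case: clJ => X -> ha x; apply: hD; rewrite -[a in LHS]sa_starK -hr_adj sa_starK.
by rewrite -hr_mul ha (addf0 (ph_ipD2 _)).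
Qed.
Lemma closed_ideal_star a : J a -> J a^#.
Proof.
by move=> Ja; apply: closed_ideal_starmul; rewrite sa_starK; apply: (closed_ideal_mul _ Ja).1.
Qed.
(** The outer factors are removed one at a time without a unit: [(a d)^# (a d)] has the form
    [c a d], so [a d] lies in [J]; then [a a^#] has the form [a d], so [a^#] and hence [a] lie in
    [J]. *)
Lemma closed_ideal_sandwich a : (forall c d, J (c ** a ** d)) -> J a.
Proof.
move=> h; have Jad d : J (a ** d).
  by apply: closed_ideal_starmul; rewrite sa_starM sa_assoc.
by rewrite -[a]sa_starK; apply/closed_ideal_star/closed_ideal_starmul; rewrite sa_starK.
Qed.
End OneAlgebra.

(** * Transport of closed ideals along a bimodule and its conjugate *)

Section Transport.
Variables (B A : hstarAlg H) (E : equivBimod B A).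

(* The representation of B induced along E by one with kernel J has kernel Phi E J. *)
Lemma Phi_closed (J : set A) : closed_ideals D J -> closed_ideals D (Phi E J).
Proof.
move=> [X ->]; exists (hinduce (eb_hrep E) X); apply/seteqP; split=> b /=.
  move=> h q; rewrite -[q]vreprK -[LHS]/(ind_la _ _) ind_laE; apply/vproj0/degenP => s.
  rewrite -[im_ip _ _]/(it_ip _ _).
  elim/tensor_ind: (vrepr q) => [|t t' IH IH'|y x].
  - by rewrite (addf0 (it_laD2 _)) (addf0 (it_ipD2 _)).
  - by rewrite it_laD2 it_ipD2 IH IH' addr0.
  elim/tensor_ind: s => [|s s' IH IH'|y' x'].
  - by rewrite (addf0 (it_ipD1 _)).
  - by rewrite it_ipD1 IH IH' addr0.
  by rewrite it_laE it_ipE [hr_pi _ x]h (addf0 (ph_ipD2 _)).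
(* Pairing [x ⊗ w] with [b y ⊗ z] gives [<w, pi(<x, b y>) z>]; as [w] is arbitrary, non-degeneracy
   yields [pi(<x, b y>) z = 0]. *)
move=> h x y z; apply: ph_ext => w; rewrite (addf0 (ph_ipD2 _)).
have := h (vproj _ (tpure (@ph_act _ A (eb_hrep E)) (@hr_pi _ _ _ _ X) y z)).
rewrite -[LHS]/(ind_la _ _) ind_laE => /vproj_eq0/degenP.
move=> /(_ (tpure (@ph_act _ A (eb_hrep E)) (@hr_pi _ _ _ _ X) x w)).
by rewrite -[im_ip _ _]/(it_ip _ _) it_laE it_ipE.
Qed.

Lemma Phi_subset (J K : set A) : J `<=` K -> Phi E J `<=` Phi E K.
Proof. by move=> JK b h x y; apply/JK/h. Qed.

(** Conjugating twice only replaces the action of [b] by that of [b^#^#]. Thus the second inverse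
    law follows from the first, applied to the conjugate. *)
Lemma Phi_conj_conj (J : set A) : Phi (conjBimod (conjBimod E)) J = Phi E J.
Proof.
apply/seteqP; split=> b h x y; first by have := h x y; rewrite /= /cj_ra /= /cj_la sa_starK.
by rewrite /= /cj_ra /= /cj_la sa_starK; apply: h.
Qed.

(** The left side is what membership of [a] in [Phi (conjBimod E) (Phi E J)] tests:
    [eb_lip x (eb_ra y a^#)] is the inner product of [x] with [a] acting on [y] in the conjugate. *)
Lemma eb_rip_lip_rip (u v x y : E) (a : A) :
  eb_rip u (eb_la (eb_lip x (eb_ra y a^#)) v) = eb_rip u x ** a ** eb_rip y v.
Proof.
have r := eb_is_rip E.
rewrite eb_compat (rip_act r) (rip_star r (eb_ra _ _)) (rip_act r) sa_starM sa_starK.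
by rewrite -(rip_star r) sa_assoc.
Qed.

Lemma Phi_conjK (hD : admissible D) (J : set A) :
  closed_ideals D J -> Phi (conjBimod E) (Phi E J) = J.
Proof.
move=> clJ; apply/seteqP; split=> a.
  move=> h; apply: (closed_ideal_sandwich clJ hD) => c d.
  apply: (closed_ideal_lspan clJ (f := fun c : A => c ** a ** d)) (@eb_rfull _ _ _ _ E c).
    by move=> k c1 c2; rewrite !mulDl !mulZl.
  move=> _ [u [x ->]].
  apply: (closed_ideal_lspan clJ (f := fun d : A => _ ** d)) (@eb_rfull _ _ _ _ E d).
    by move=> k d1 d2; rewrite mulDr mulZr.
  move=> _ [y [v ->]]; rewrite -eb_rip_lip_rip.
  exact: (h x y u v).
move=> Ja x y u v.
rewrite -[eb_rip (e := conjBimod E) _ _]/(eb_lip (x : E) (eb_ra (y : E) a^#)) eb_rip_lip_rip.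
exact: (closed_ideal_mul clJ _ (closed_ideal_mul clJ _ Ja).2).1.
Qed.
End Transport.

(** * The lattice isomorphism *)

Lemma Phi_conjKV (hD : admissible D) (B A : hstarAlg H) (E : equivBimod B A) (K : set B) :
  closed_ideals D K -> Phi E (Phi (conjBimod E) K) = K.
Proof. by move=> clK; rewrite -Phi_conj_conj Phi_conjK. Qed.

Lemma Phi_lattice_iso (hD : admissible D) (B A : hstarAlg H) (E : equivBimod B A) :
  lattice_iso D (Phi E).
Proof.
split.
- split=> [J|J J' /set_mem clJ /set_mem clJ' e|K clK]; first exact: Phi_closed.
    by rewrite -(Phi_conjK E hD clJ) e Phi_conjK.
  by exists (Phi (conjBimod E) K); [exact: Phi_closed|exact: Phi_conjKV].
- move=> I J _ _; apply/seteqP; split=> [b h|b [hI hJ] x y]; last by split; [apply: hI|apply: hJ].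
  by split=> x y; case: (h x y).
move=> I J clI clJ; apply/seteqP; split=> b h.
  (* Any closed [K] above both images is itself the image of [Phi (conjBimod E) K], a closed ideal
     above [I] and [J] by monotonicity. *)
  move=> K [clK IJK]; rewrite -(Phi_conjKV hD E clK) => x y; apply: h.
  split; first exact: Phi_closed.
  rewrite -{1}(Phi_conjK E hD clI) -{1}(Phi_conjK E hD clJ) => a [] ha;
    apply: (Phi_subset _ ha) => c hc; apply: IJK; by [left|right].
(* Conversely, each closed [K] above [I] and [J] gives the closed ideal [Phi E K] above both
   images. *)
move=> x y K [clK IJK]; apply: (h (Phi E K)); split; first exact: Phi_closed.
by move=> c [] hc; apply: (Phi_subset _ hc) => a ha; apply: IJK; by [left|right].
Qed.

(** * Compatibility with isomorphism, composition and units *)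

Lemma Phi_isomorphic (B A : hstarAlg H) (E E' : equivBimod B A) (J : set A) :
  ebimod_isomorphic E E' -> Phi E J = Phi E' J.
Proof.
move=> [f fE]; have [g fK gK] := ei_bij fE; apply/seteqP; split=> b h x y.
  by rewrite -[x]gK -[y]gK -(ei_la fE) (ei_rip fE); apply: h.
by rewrite -(ei_rip fE) (ei_la fE); apply: h.
Qed.

(** On pure tensors [<y ⊗ x, c y' ⊗ x'> = <x, <y, c y'> x'>], so both sides impose the same
    condition there; additivity of [J] extends it to all classes. *)
Lemma Phi_itensor (G B A : picObj H) (F : equivBimod G B) (E : equivBimod B A)
    (J : set A) : closed_ideals D J -> Phi (itensor F E) J = Phi F (Phi E J).
Proof.
move=> clJ; apply/seteqP; split=> c.
  move=> h y y' x x'.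
  pose v (y : F) (x : E) : itensor F E := vproj _ (tpure _ _ y x).
  have := h (v y x) (v y' x').
  rewrite -[eb_la c _]/(ind_la _ _) ind_laE -[eb_rip _ _]/(dq_ip _ _) dq_ipE.
  by rewrite -[im_ip _ _]/(it_ip _ _) it_laE it_ipE.
move=> h p q; rewrite (ind_repr p) (ind_repr q).
rewrite -[eb_la c _]/(ind_la _ _) ind_laE -[eb_rip _ _]/(dq_ip _ _) dq_ipE.
rewrite -[im_ip _ _]/(it_ip _ _).
have JD a b : J a -> J b -> J (a + b).
  by move=> ha hb; rewrite -[a]scale1r; apply: closed_idealD.
elim/tensor_ind: (vrepr q) => [|t t' IH IH'|y' x'].
- by rewrite (addf0 (it_laD2 _)) (addf0 (it_ipD2 _)); apply: closed_ideal0.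
- by rewrite it_laD2 it_ipD2; apply: JD.
elim/tensor_ind: (vrepr p) => [|s s' IH IH'|y x].
- by rewrite (addf0 (it_ipD1 _)); apply: closed_ideal0.
- by rewrite it_ipD1; apply: JD.
by rewrite it_laE it_ipE; apply: h.
Qed.

(** Here [<x, a y>] is [x^# a y], so [closed_ideal_sandwich] gives one inclusion and the ideal
    property the other. *)
Lemma Phi_unitBimod (hD : admissible D) (A : picObj H) (J : set A) :
  closed_ideals D J -> Phi (unitBimod A) J = J.
Proof.
move=> clJ; apply/seteqP; split=> a h.
  apply: (closed_ideal_sandwich clJ hD) => c d.
  by rewrite -sa_assoc -[c]sa_starK; apply: h.
move=> x y; rewrite -[eb_rip _ _]/(x^# ** (a ** y)).
exact: (closed_ideal_mul clJ _ (closed_ideal_mul clJ y h).1).2.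
Qed.
End ClosedIdeals.

Theorem theorem5p9 (R : realDomainType) (H : hopfStarAlg R) (D : hstarAlg H)
    (hD : admissible D) :
  [/\ forall (B A : picObj H) (E : equivBimod B A), lattice_iso D (Phi E),
      forall (B A : picObj H) (E E' : equivBimod B A), ebimod_isomorphic E E' ->
        forall J : set A, closed_ideals D J -> Phi E J = Phi E' J,
      forall (G B A : picObj H) (F : equivBimod G B) (E : equivBimod B A)
        (J : set A), closed_ideals D J ->
        Phi (itensor F E) J = Phi F (Phi E J) &
      forall (A : picObj H) (J : set A), closed_ideals D J ->
        Phi (unitBimod A) J = J].
Proof.
split=> [B A E|B A E E' EE' J _|G B A F E J clJ|A J clJ].
- exact: Phi_lattice_iso.
- exact: Phi_isomorphic.
- exact: Phi_itensor clJ.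
- exact: Phi_unitBimod clJ.
Qed.
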